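(* Let $R$ be a commutative Noetherian ring and let $M \neq (0)$ be a finitely generated $R$-module of (finite) dimension $d$. Suppose that $\dim R/\mathfrak{p} = \dim R_P/\mathfrak{p}R_P$ for every $\mathfrak{p} \in \mathrm{Ass}_R M$ and for every maximal ideal $P$ of $R$ such that $\mathfrak{p} \subseteq P$. Then the following conditions are equivalent. (1) $M$ is a sequentially Cohen-Macaulay $R$-module. (2) $M_P$ is a sequentially Cohen-Macaulay $R_P$-module for every $P \in \mathrm{Supp}_R M$.
   Context: Rings are commutative and Noetherian. Let $M \neq (0)$ be a finitely generated module of finite dimension over a Noetherian ring $R$. For each $n \in \mathbb{Z}$ there is a largest $R$-submodule $M_n$ of $M$ with $\dim_R M_n \le n$ (convention: $\dim_R (0) = -\infty$). Put $\mathcal{S}(M) = \{\dim_R N \mid N \text{ is an } R\text{-submodule of } M,\ N \neq (0)\} = \{\dim R/\mathfrak{p} \mid \mathfrak{p} \in \mathrm{Ass}_R M\}$, a finite set, and write $\mathcal{S}(M) = \{d_1 < d_2 < \cdots < d_\ell = \dim_R M\}$. The dimension filtration of $M$ is the chain $D_0 = (0) \subsetneq D_1 \subsetneq \cdots \subsetneq D_\ell = M$ with $D_i = M_{d_i}$ for $1 \le i \le \ell$. $M$ is called a sequentially Cohen-Macaulay $R$-module if $D_i/D_{i-1}$ is a Cohen-Macaulay $R$-module for every $1 \le i \le \ell$. (A finitely generated module $C$ over a Noetherian ring is Cohen-Macaulay if $C_P$ is a Cohen-Macaulay $R_P$-module for every maximal ideal $P$ in its support.) *)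

(* Defs.v *)
From HB Require Import structures.
From mathcomp Require Import all_boot all_order all_algebra ring_quotient.
From mathcomp Require Import ring.
From mathcomp Require Import boolp classical_sets constructive_ereal.

Set Implicit Arguments.
Unset Strict Implicit.
Unset Printing Implicit Defensive.

Import Order.TTheory GRing.Theory Num.Theory.

Local Open Scope ring_scope.
Local Open Scope quotient_scope.
Local Open Scope classical_set_scope.

(* Submodules of V are the library's [submodClosed V]; ideals of R, including
   the unit ideal, are [submodClosed R^o], while [idealr R] and
   [prime_idealr R] are the proper and the prime ideals. *)

Section Submodules.
Variables (R : comNzRingType) (V : lmodType R).

Section SubmoduleType.
Variable N : submodClosed V.

Definition subm := {x : V | x \in N}.

HB.instance Definition _ := SubChoice.on subm.
HB.instance Definition _ := GRing.SubChoice_isSubLmodule.Build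
  R V [in N] subm (GRing.subsemimodClosedP N).

End SubmoduleType.

Section Restrict.
Variables N K : submodClosed V.

Definition restr : {pred subm N} := fun x => val x \in K.

Lemma restr_closed : subsemimod_closed restr.
Proof.
split=> [|a x Kx]; last exact: (@rpredZ _ _ K a _ Kx).
by split=> [|x y Kx Ky]; [exact: (@rpred0 _ K) | exact: (@rpredD _ K _ _ Kx)].
Qed.

HB.instance Definition _ :=
  GRing.isSubmodClosed.Build R (subm N) restr restr_closed.

End Restrict.

Section Generated.
Variable X : set V.

Definition gensub : {pred V} :=
  fun x => `[< forall N : submodClosed V, X `<=` [set` N] -> x \in N >].

Lemma gensub_closed : subsemimod_closed gensub.
Proof.
split=> [|a x /asboolP Nx]; last first.
  by apply/asboolP => N XN; rewrite rpredZ// Nx.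
split=> [|x y /asboolP Nx /asboolP Ny]; apply/asboolP => N XN.
  exact: rpred0.
by rewrite rpredD ?Nx ?Ny.
Qed.

HB.instance Definition _ := GRing.isSubmodClosed.Build R V gensub gensub_closed.

End Generated.

Section Quotient.
Variable N : submodClosed V.

Let N_zmod : {pred V} := N.

HB.instance Definition _ :=
  GRing.isSubmodClosed.Build R V N_zmod (GRing.subsemimodClosedP N).

Definition quotm := Quotient.quot N_zmod.

HB.instance Definition _ := GRing.Zmodule.on quotm.

Lemma quotm_addE v w : \pi_quotm (v + w) = \pi_quotm v + \pi_quotm w.
Proof. exact: Quotient.pi_add. Qed.

Definition quotm_scale (a : R) (x : quotm) : quotm := \pi_quotm (a *: repr x).

Lemma quotm_scaleE a v : quotm_scale a (\pi_quotm v) = \pi_quotm (a *: v).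
Proof.
apply/eqP; rewrite -Quotient.idealrBE -scalerBr rpredZ//.
by rewrite Quotient.idealrBE reprK.
Qed.

Lemma quotm_scaleA a b x :
  quotm_scale a (quotm_scale b x) = quotm_scale (a * b) x.
Proof. by rewrite -[x]reprK (quotm_scaleE b) !quotm_scaleE scalerA. Qed.

Lemma quotm_scale1 : left_id 1 quotm_scale.
Proof. by move=> x; rewrite -[x]reprK quotm_scaleE scale1r. Qed.

Lemma quotm_scaleDr : right_distributive quotm_scale +%R.
Proof.
move=> a x y; rewrite -[x]reprK -[y]reprK -quotm_addE !quotm_scaleE.
by rewrite scalerDr quotm_addE.
Qed.

Lemma quotm_scaleDl x : {morph quotm_scale^~ x : a b / a + b}.
Proof.
by move=> a b; rewrite -[x]reprK !quotm_scaleE scalerDl quotm_addE.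
Qed.

HB.instance Definition _ := GRing.Zmodule_isLmodule.Build R quotm
  quotm_scaleA quotm_scale1 quotm_scaleDr quotm_scaleDl.

End Quotient.

End Submodules.

Section Localization.
Variables (R : comNzRingType) (P : prime_idealr R).

Record denom := Denom { dval :> R; _ : dval \notin P }.
HB.instance Definition _ := [isSub for dval].
HB.instance Definition _ := [Choice of denom by <:].

Lemma denom1_subproof : 1 \notin P. Proof. by rewrite idealr1. Qed.
Definition denom1 := Denom denom1_subproof.

Lemma denomM_subproof (s t : denom) : dval s * dval t \notin P.
Proof. by rewrite prime_idealrM negb_or (valP s) (valP t). Qed.
Definition denomM s t := Denom (denomM_subproof s t).

Section LocalizedModule.
Variable V : lmodType R.

Definition lfrac_eq (x y : V * denom) : bool :=
  `[< exists u : denom,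
      dval u *: (dval y.2 *: x.1) = dval u *: (dval x.2 *: y.1) >].

Lemma lfrac_eq_equiv : equiv_class_of lfrac_eq.
Proof.
split=> [x|x y|y x z].
- by apply/asboolP; exists denom1.
- by apply/asboolP/asboolP => -[u uE]; exists u.
move=> /asboolP[u uE] /asboolP[w wE]; apply/asboolP.
exists (denomM (denomM u w) y.2) => /=.
rewrite !scalerA in uE wE *.
transitivity ((dval w * dval z.2) *: ((dval u * dval y.2) *: x.1)).
  by rewrite scalerA; congr (_ *: _); ring.
rewrite uE scalerA.
transitivity ((dval u * dval x.2) *: ((dval w * dval z.2) *: y.1)).
  by rewrite scalerA; congr (_ *: _); ring.
by rewrite wE scalerA; congr (_ *: _); ring.
Qed.

Canonical lfrac_eq_equiv_rel := EquivRelPack lfrac_eq_equiv.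
Canonical lfrac_eq_encModRel := defaultEncModRel lfrac_eq.

(* The localization V_P, as the quotient of V * (R \ P) by
   (v, s) ~ (w, t) <-> u t v = u s w for some u in R \ P. *)
Definition locm := {eq_quot lfrac_eq}.
HB.instance Definition _ : EqQuotient _ lfrac_eq locm := EqQuotient.on locm.
HB.instance Definition _ := Choice.on locm.

Definition lfrac (v : V) (s : denom) : locm := \pi_locm (v, s).

Lemma lfracP v s w t :
  lfrac v s = lfrac w t <->
  exists u : denom, dval u *: (dval t *: v) = dval u *: (dval s *: w).
Proof.
split=> [/eqP|vw].
  by rewrite /lfrac piE => /asboolP.
by apply/eqP; rewrite /lfrac piE; apply/asboolP.
Qed.

Lemma lfracE x : exists v s, x = lfrac v s.
Proof. by exists (repr x).1, (repr x).2; rewrite /lfrac -surjective_pairing reprK. Qed.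

Definition locm_zero : locm := lfrac 0 denom1.

Definition locm_opp (x : locm) : locm := lfrac (- (repr x).1) (repr x).2.

Definition locm_add (x y : locm) : locm :=
  lfrac (dval (repr y).2 *: (repr x).1 + dval (repr x).2 *: (repr y).1)
       (denomM (repr x).2 (repr y).2).

Lemma repr_lfrac v s : lfrac (repr (lfrac v s)).1 (repr (lfrac v s)).2 = lfrac v s.
Proof. by rewrite {1}/lfrac -surjective_pairing reprK. Qed.

Lemma locm_oppE v s : locm_opp (lfrac v s) = lfrac (- v) s.
Proof.
have /lfracP[u uE] := repr_lfrac v s.
by apply/lfracP; exists u; rewrite !scalerN uE.
Qed.

Lemma locm_addE v s w t :
  locm_add (lfrac v s) (lfrac w t) =
  lfrac (dval t *: v + dval s *: w) (denomM s t).
Proof.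
have /lfracP[u] := repr_lfrac v s; have /lfracP[u'] := repr_lfrac w t.
rewrite /locm_add.
case: (repr (lfrac v s)) (repr (lfrac w t)) => v' s' [w' t'] /=.
rewrite !scalerA => wE vE; apply/lfracP; exists (denomM u u') => /=.
rewrite !scalerDr !scalerA; congr (_ + _).
  transitivity ((dval u' * dval t * dval t') *: ((dval u * dval s) *: v')).
    by rewrite scalerA; congr (_ *: _); ring.
  by rewrite vE scalerA; congr (_ *: _); ring.
transitivity ((dval u * dval s * dval s') *: ((dval u' * dval t) *: w')).
  by rewrite scalerA; congr (_ *: _); ring.
by rewrite wE scalerA; congr (_ *: _); ring.
Qed.

Lemma locm_addC : commutative locm_add.
Proof.
move=> x y; have [v [s ->]] := lfracE x; have [w [t ->]] := lfracE y.
rewrite !locm_addE addrC; apply/lfracP; exists denom1 => /=.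
by rewrite mulrC.
Qed.

Lemma locm_addA : associative locm_add.
Proof.
move=> x y z; have [v [s ->]] := lfracE x; have [w [t ->]] := lfracE y.
have [z' [r ->]] := lfracE z; rewrite !locm_addE.
apply/lfracP; exists denom1 => /=.
rewrite !scalerDr !scalerA addrA.
by congr (_ *: _ + _ *: _ + _ *: _); ring.
Qed.

Lemma locm_add0 : left_id locm_zero locm_add.
Proof.
move=> x; have [v [s ->]] := lfracE x; rewrite locm_addE.
by apply/lfracP; exists denom1; rewrite /= scaler0 add0r !scale1r mul1r.
Qed.

Lemma locm_addN : left_inverse locm_zero locm_opp locm_add.
Proof.
move=> x; have [v [s ->]] := lfracE x; rewrite locm_oppE locm_addE.
by apply/lfracP; exists denom1; rewrite /= scalerN addNr !scaler0.
Qed.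

HB.instance Definition _ :=
  GRing.isZmodule.Build locm locm_addA locm_addC locm_add0 locm_addN.

Lemma lfrac0 : lfrac 0 denom1 = 0. Proof. by []. Qed.

Lemma lfracN v s : lfrac (- v) s = - lfrac v s.
Proof. by rewrite -locm_oppE. Qed.

Lemma lfracD v s w t :
  lfrac v s + lfrac w t = lfrac (dval t *: v + dval s *: w) (denomM s t).
Proof. exact: locm_addE. Qed.

End LocalizedModule.

Definition locr := locm R^o.
HB.instance Definition _ := GRing.Zmodule.on locr.

Definition lfracr (a : R) (s : denom) : locr := lfrac (a : R^o) s.

Lemma lfracrE (x : locr) : exists a s, x = lfracr a s.
Proof. by have [a [s ->]] := @lfracE R^o x; exists a, s. Qed.

Lemma lfracrP a s b t :
  lfracr a s = lfracr b t <->
  exists u : denom, dval u * (dval t * a) = dval u * (dval s * b).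
Proof. exact: lfracP. Qed.

Lemma repr_lfracr a s : lfracr (repr (lfracr a s)).1 (repr (lfracr a s)).2 = lfracr a s.
Proof. exact: repr_lfrac. Qed.

Section Scale.
Variable V : lmodType R.

Definition locm_scale (a : locr) (x : locm V) : locm V :=
  lfrac (((repr a).1 : R) *: (repr x).1) (denomM (repr a).2 (repr x).2).

Lemma locm_scaleE a s v t :
  locm_scale (lfracr a s) (lfrac v t) = lfrac (a *: v) (denomM s t).
Proof.
have /lfracrP[u] := repr_lfracr a s; have /lfracP[u'] := repr_lfrac v t.
rewrite /locm_scale.
case: (repr (lfrac v t)) => v' t'; case: (repr (lfracr a s)) => a' s'.
rewrite [(_, _).1]/= [(_, _).2]/= [(a', _).1]/= [(a', _).2]/=.
rewrite !scalerA => vE aE.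
apply/lfracP; exists (denomM u u').
rewrite /= !scalerA.
transitivity ((dval u * (dval s * a')) *: ((dval u' * dval t) *: v')).
  by rewrite scalerA; congr (_ *: _); ring.
by rewrite vE aE scalerA; congr (_ *: _); ring.
Qed.

End Scale.

Definition locr_one : locr := lfracr 1 denom1.
Definition locr_mul (x y : locr) : locr := @locm_scale R^o x y.

Lemma locr_mulE a s b t :
  locr_mul (lfracr a s) (lfracr b t) = lfracr (a * b) (denomM s t).
Proof. exact: locm_scaleE. Qed.

Lemma lfracrD a s b t :
  lfracr a s + lfracr b t = lfracr (dval t * a + dval s * b) (denomM s t).
Proof. exact: lfracD. Qed.

Lemma locr_mulA : associative locr_mul.
Proof.
move=> x y z; have [a [s ->]] := lfracrE x; have [b [t ->]] := lfracrE y.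
have [c [r ->]] := lfracrE z; rewrite !locr_mulE.
by apply/lfracrP; exists denom1 => /=; ring.
Qed.

Lemma locr_mulC : commutative locr_mul.
Proof.
move=> x y; have [a [s ->]] := lfracrE x; have [b [t ->]] := lfracrE y.
by rewrite !locr_mulE; apply/lfracrP; exists denom1 => /=; ring.
Qed.

Lemma locr_mul1 : left_id locr_one locr_mul.
Proof.
move=> x; have [a [s ->]] := lfracrE x; rewrite locr_mulE.
by apply/lfracrP; exists denom1 => /=; ring.
Qed.

Lemma locr_mulD : left_distributive locr_mul +%R.
Proof.
move=> x y z; have [a [s ->]] := lfracrE x; have [b [t ->]] := lfracrE y.
have [c [r ->]] := lfracrE z; rewrite lfracrD !locr_mulE lfracrD.
by apply/lfracrP; exists denom1 => /=; ring.
Qed.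

Lemma locr_one_neq0 : locr_one != 0.
Proof.
apply/eqP => /lfracrP[u]; rewrite /= !mulr1 !mulr0 => u0.
by have := valP u; rewrite /= u0 (idealr0 P).
Qed.

HB.instance Definition _ := GRing.Zmodule_isComNzRing.Build locr
  locr_mulA locr_mulC locr_mul1 locr_mulD locr_one_neq0.

Section LocalizedModuleStructure.
Variable V : lmodType R.

Lemma locm_scaleA (a b : locr) (x : locm V) :
  locm_scale a (locm_scale b x) = locm_scale (a * b) x.
Proof.
have [c [s ->]] := lfracrE a; have [d [t ->]] := lfracrE b.
have [v [r ->]] := lfracE x; rewrite [_ * _]locr_mulE !locm_scaleE.
apply/lfracP; exists denom1 => /=; rewrite !scalerA.
by congr (_ *: _); ring.
Qed.

Lemma locm_scale1 : left_id 1 (@locm_scale V).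
Proof.
move=> x; have [v [r ->]] := lfracE x; rewrite [LHS](locm_scaleE 1 denom1).
by apply/lfracP; exists denom1; rewrite /= mul1r scale1r.
Qed.

Lemma locm_scaleDr : right_distributive (@locm_scale V) +%R.
Proof.
move=> a x y; have [c [s ->]] := lfracrE a.
have [v [r ->]] := lfracE x; have [w [t ->]] := lfracE y.
rewrite lfracD !locm_scaleE lfracD.
apply/lfracP; exists denom1 => /=; rewrite !scalerDr !scalerA.
by congr (_ *: _ + _ *: _); ring.
Qed.

Lemma locm_scaleDl (x : locm V) : {morph (@locm_scale V)^~ x : a b / a + b}.
Proof.
move=> a b; have [c [s ->]] := lfracrE a; have [d [t ->]] := lfracrE b.
have [v [r ->]] := lfracE x; rewrite lfracrD !locm_scaleE lfracD.
apply/lfracP; exists denom1 => /=; rewrite !scalerA -!scalerDl scalerA.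
by congr (_ *: _); ring.
Qed.

HB.instance Definition _ := GRing.Zmodule_isLmodule.Build locr (locm V)
  locm_scaleA locm_scale1 locm_scaleDr locm_scaleDl.

End LocalizedModuleStructure.

End Localization.

Section CommutativeAlgebra.
Variable R : comNzRingType.

Definition fingen (V : lmodType R) : Prop :=
  exists s : seq V, forall v,
    exists c : 'I_(size s) -> R, v = \sum_i c i *: s`_i.

Definition noetherian : Prop := forall I : submodClosed R^o, fingen (subm I).

Definition maximal (I : idealr R) : Prop :=
  forall J : idealr R, {subset I <= J} -> {subset J <= I}.

Lemma idealr_submod_closed (I : idealr R) :
  @subsemimod_closed R R^o (I : {pred R}).
Proof.
by split=> [|a x]; [split=> [|x y]; [exact: rpred0|exact: rpredD]|exact: idealMr].
Qed.

Definition ideal_pred (I : idealr R) : {pred R^o} := (I : {pred R}).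
HB.instance Definition _ (I : idealr R) :=
  GRing.isSubmodClosed.Build R R^o (ideal_pred I) (idealr_submod_closed I).

Definition supp (V : lmodType R) (p : prime_idealr R) : Prop :=
  exists x : locm p V, x != 0.

Definition ass (V : lmodType R) (p : prime_idealr R) : Prop :=
  exists v : V, forall a, (a \in p) = (a *: v == 0).

Definition chain_lengths (X : prime_idealr R -> Prop) : set nat :=
  [set n | exists p : nat -> prime_idealr R,
     (forall i, (i <= n)%N -> X (p i)) /\
     (forall i, (i < n)%N -> [set` p i] `<` [set` p i.+1])].

(* The Krull dimension of V: the supremum in Z U {-oo, +oo} of the lengths
   of the chains of primes in its support; in particular dim 0 = -oo. *)
Definition mdim (V : lmodType R) : \bar int :=
  supremum -oo%E [set (n%:Z)%:E | n in chain_lengths (supp V)]%E.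

(* The submodule (s_1, ..., s_n) V. *)
Definition mul_seq (s : seq R) (V : lmodType R) : submodClosed V :=
  gensub [set a *: v | a in [set` s] & v in [set: V]].

Definition regular_seq (V : lmodType R) (s : seq R) : Prop :=
  (forall i, (i < size s)%N ->
     injective (fun v : quotm (mul_seq (take i s) V) => s`_i *: v)) /\
  (exists v : quotm (mul_seq s V), v != 0).

Definition depth (I : idealr R) (V : lmodType R) : \bar int :=
  supremum -oo%E [set (size s)%:Z%:E | s in
    [set s : seq R | {subset s <= I} /\ regular_seq V s]]%E.

(* R is local with maximal ideal m and V is Cohen-Macaulay; the zero module
   qualifies since its depth and its dimension are both -oo. *)
Definition local_cohen_macaulay (V : lmodType R) : Prop :=
  exists m : idealr R,
    [/\ maximal m, (forall n : idealr R, maximal n -> n =i m)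
       & depth m V = mdim V].

End CommutativeAlgebra.

Definition cohen_macaulay (R : comNzRingType) (V : lmodType R) : Prop :=
  forall P : prime_idealr R, maximal P -> supp V P ->
    local_cohen_macaulay (locm P V).

Section SequentiallyCohenMacaulay.
Variables (R : comNzRingType) (V : lmodType R).

Definition largest_dim_le (n : int) (N : submodClosed V) : Prop :=
  (mdim (subm N) <= n%:E)%E /\
  forall K : submodClosed V, (mdim (subm K) <= n%:E)%E -> {subset K <= N}.

Definition submodule_dims : set (\bar int) :=
  [set e | exists N : submodClosed V,
     (exists2 v, v \in N & v != 0) /\ mdim (subm N) = e].

(* The dimension filtration D_0, ..., D_l, where ds = [:: d_1; ...; d_l];
   the values D_i with i > l are irrelevant. *)
Definition dimension_filtration
    (ds : seq int) (D : nat -> submodClosed V) : Prop :=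
  [/\ sorted <%O ds,
      submodule_dims = [set` map EFin ds],
      D 0%N =i pred1 0
    & forall i, (i < size ds)%N -> largest_dim_le ds`_i (D i.+1)].

(* The quotient of N by the submodule K `&` N. *)
Definition subquot (N K : submodClosed V) := quotm (@restr R V N K).

Definition sequentially_cohen_macaulay : Prop :=
  exists ds D, dimension_filtration ds D /\
    forall i, (i < size ds)%N -> cohen_macaulay (subquot (D i.+1) (D i)).

End SequentiallyCohenMacaulay.

(* The ideal p R_P of R_P, as a submodule of R_P. *)
Definition extended_ideal (R : comNzRingType) (p : idealr R)
    (P : prime_idealr R) : submodClosed (locr P)^o :=
  @gensub _ (locr P)^o
    [set x : (locr P)^o | exists2 a, a \in p & x = lfracr a (denom1 P)].

(* Main.v *)
(* Let F_n be the submodule of all v whose annihilator has coheight < n; it is the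
   largest submodule of dimension < n, and M is sequentially Cohen-Macaulay iff
   every layer F_(n+1) / F_n is Cohen-Macaulay. The associated primes of the n-th
   layer are associated primes of M of coheight exactly n.
   For a maximal ideal P the hypothesis says that these coheights are unchanged in
   R_P, so (F_n)_P is the n-th term for M_P and the layers of M_P are the localized
   layers of M: this gives (2) => (1). For (1) => (2) choose a maximal ideal Q
   containing P and let c be the coheight of P in R_Q. If C is the n-th
   layer, C_Q is Cohen-Macaulay, hence has a regular sequence of length n - c inside P. Since a
   regular sequence of length k forces every associated prime to have coheight at
   least k, all associated primes of C_P have coheight n - c. Thus C_P is
   Cohen-Macaulay of dimension n - c, and the filtration of M_P is that of M
   localized and shifted by c. *)

From HB Require Import structures.
Require Import Defs.
From mathcomp Require Import all_boot all_order all_algebra ring_quotient.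
From mathcomp Require Import ring zify.
From mathcomp Require Import boolp classical_sets constructive_ereal.

Set Implicit Arguments.
Unset Strict Implicit.
Unset Printing Implicit Defensive.

Import Order.TTheory GRing.Theory Num.Theory.

Local Open Scope ring_scope.
Local Open Scope classical_set_scope.

(** * Noetherian modules *)

(** The delicate point is to compare regularity at two primes $P \subseteq Q$. Towers of localized
    quotients are avoided by keeping one module [W] and varying a submodule [N]: denominators are
    absorbed in the saturation [sat P N], and division by [x] replaces [N] by [addmul x N]. These
    notions are matched with actual localizations afterwards.

    A regular sequence in $Q$ does not by itself give one in $P$. As long as its length exceeds $c$,
    no associated prime of $(W/N)_Q$ contains $P$, since its coheight would be too large; prime
    avoidance then finds a regular element in $P$. Making it the first term requires that grade does
    not depend on the chosen regular element, which is proved by an elementary exchange instead of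
    Ext.

    Layers are indexed by all $n$, not only by the dimensions of submodules: the others vanish, and
    the shift by $c$ becomes a translation of the index. The coheight hypothesis concerns Ass $M$;
    it reaches the layers because an associated prime of a layer lying strictly above one of $M$
    would give too long a chain over the annihilator of an element of $F_{n+1}$. *)

Lemma scaleCA (R : comNzRingType) (V : lmodType R) (a b : R) (v : V) :
  a *: (b *: v) = b *: (a *: v).
Proof. by rewrite !scalerA mulrC. Qed.

Section Noetherian.
Variables (R : comNzRingType) (W : lmodType R).
Implicit Types (N K : set W) (u v w : W) (s t : seq W).

(** Submodules as sets, so that saturations, preimages and families of submodules are given by
    comprehension; [set_submodClosed] leads back to the bundled type. *)
Record submodule (N : set W) : Prop := Submodule {
  sub0 : N 0;
  subD : forall u v, N u -> N v -> N (u + v);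
  subZ : forall a v, N v -> N (a *: v) }.

Lemma subN N v : submodule N -> N v -> N (- v).
Proof. by move=> sN Nv; rewrite -scaleN1r; apply: subZ. Qed.

Lemma subB N u v : submodule N -> N u -> N v -> N (u - v).
Proof. by move=> sN Nu Nv; apply: subD => //; apply: subN. Qed.

Lemma subDr N u v : submodule N -> N u -> N (u + v) -> N v.
Proof. by move=> sN Nu Nuv; rewrite -(addKr u v) addrC; apply: subB. Qed.

Lemma submodule0 : submodule [set 0].
Proof.
by split=> [//|u v -> ->|a v ->] /=; rewrite ?addr0 ?scaler0.
Qed.

Lemma submodulep (N : submodClosed W) : submodule [set` N].
Proof.
split=> [|u v|a v] /=; [exact: rpred0 | exact: rpredD | exact: (@rpredZ _ _ N)].
Qed.

(** The maximal condition is the form in which finiteness is used: associated primes, Nakayama's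
    lemma and the finiteness of Ass all pick a maximal member of a family. *)
Definition noetherian_module :=
  forall F : set (set W), F `<=` submodule -> F !=set0 ->
    exists2 N, F N & forall K, F K -> N `<=` K -> K `<=` N.

Fixpoint span s : set W :=
  if s is x :: s' then [set v | exists a w, span s' w /\ v = a *: x + w]
  else [set 0].

Lemma span_submodule s : submodule (span s).
Proof.
elim: s => [|x s IH] /=; first exact: submodule0.
split=> [|u v [a [w [sw ->]]] [b [w' [sw' ->]]]|b v [a [w [sw ->]]]].
- by exists 0, 0; rewrite scale0r addr0; split=> //; apply: sub0.
- by exists (a + b), (w + w'); rewrite scalerDl addrACA; split=> //; apply: subD.
- by exists (b * a), (b *: w); rewrite scalerDr scalerA; split=> //; apply: subZ.
Qed.

Lemma span_sub s N : submodule N -> (forall x, x \in s -> N x) -> span s `<=` N.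
Proof.
move=> sN; elim: s => [|x s IH] sub v /= => [->|[a [w [sw ->]]]]; first exact: sub0.
apply: subD => //; first by apply: subZ => //; apply: sub; rewrite mem_head.
by apply: IH => // y ys; apply: sub; rewrite in_cons ys orbT.
Qed.

Lemma mem_span s x : x \in s -> span s x.
Proof.
elim: s => [//|y s IH] /=; rewrite in_cons => /orP[/eqP<-|/IH sx].
  by exists 1, 0; rewrite scale1r addr0; split=> //; apply: sub0 (span_submodule s).
by exists 0, x; rewrite scale0r add0r.
Qed.

Lemma sum_span s (c : 'I_(size s) -> R) : span s (\sum_i c i *: s`_i).
Proof.
have sS := span_submodule s.
apply: (big_ind (span s)) => [|u v|i _]; [exact: sub0|exact: subD|].
by apply: subZ => //; apply/mem_span/mem_nth.
Qed.

(** Without a maximal member, choice builds a strictly ascending chain in [F]; its union is finitely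
    generated, and the generators already lie in one term. *)
Lemma fingen_noetherian_module :
  (forall N, submodule N -> exists2 s, (forall x, x \in s -> N x) & N `<=` span s) ->
  noetherian_module.
Proof.
move=> fg F Fsub [N0 FN0]; apply: contrapT => nomax.
have step N : exists K, F N -> [/\ F K, N `<=` K & ~ K `<=` N].
  have [FN|nFN] := pselect (F N); last by exists N.
  apply: contrapT => noK; apply: nomax; exists N => // K FK NK.
  by apply: contrapT => KN; apply: noK; exists K.
have [f fP] := choice step.
pose g n := iter n f N0.
have Fg n : F (g n) by elim: n => //= n /fP[].
have gS n : g n `<=` g n.+1 by have [] := fP _ (Fg n).
have g_mono m n : (m <= n)%N -> g m `<=` g n.
  elim: n => [|n IH]; first by rewrite leqn0 => /eqP->.
  by rewrite leq_eqVlt => /orP[/eqP-> //|/IH mn]; apply: subset_trans (gS n).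
have sU : submodule [set v | exists n, g n v].
  split=> [|u v [m gu] [n gv]|a v [n gv]].
  - by exists 0%N; apply: sub0; apply: Fsub.
  - exists (maxn m n); apply: subD; first exact: Fsub.
      exact: g_mono (leq_maxl _ _) _ gu.
    exact: g_mono (leq_maxr _ _) _ gv.
  - by exists n; apply: subZ => //; apply: Fsub.
have [s sU' Us] := fg _ sU.
have [n gs] : exists n, forall x, x \in s -> g n x.
  elim: s sU' {Us} => [|x s IH] sU'; first by exists 0%N.
  have [|n gn] := IH; first by move=> y ys; apply: sU'; rewrite in_cons ys orbT.
  have [m gm] := sU' x (mem_head _ _); exists (maxn m n) => y.
  rewrite in_cons => /orP[/eqP->|/gn]; first exact: g_mono (leq_maxl _ _) _ gm.
  exact: g_mono (leq_maxr _ _) _.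
have [_ _ []] := fP _ (Fg n); move=> v gv.
by apply: (span_sub _ gs); [apply: Fsub | apply: Us; exists n.+1].
Qed.

End Noetherian.

Section NoetherianModules.
Variables (R : comNzRingType).
Hypothesis Rn : noetherian R.

Lemma set_submodClosed (V : lmodType R) (N : set V) : submodule N ->
  exists K : submodClosed V, forall v, (v \in K) <-> N v.
Proof.
move=> sN.
have cN : subsemimod_closed (fun v => `[< N v >]).
  split=> [|a v /asboolP Nv]; last by apply/asboolP; apply: subZ.
  split=> [|u v /asboolP Nu /asboolP Nv]; apply/asboolP; first exact: sub0.
  exact: subD.
pose m := GRing.isSubmodClosed.Build R V _ cN.
pose K : submodClosed V := HB.pack (fun v => `[< N v >]) m.
by exists K => v; apply: iff_sym; exact: (rwP (asboolP (N v))).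
Qed.

Lemma ideal_span (J : set R^o) : submodule J ->
  exists2 js, (forall x, x \in js -> J x) & J `<=` span js.
Proof.
move=> /set_submodClosed[I JI]; have [s sP] := Rn I.
exists (map val s) => [_ /mapP[x xs ->]|v /JI Iv]; first exact/JI/(valP x).
have [c vE] := sP (Sub v Iv).
have -> : v = \sum_i c i *: (val s`_i) :> R^o.
  transitivity (val (Sub v Iv : subm I)); first by rewrite SubK.
  rewrite {1}vE raddf_sum; apply: eq_bigr => i _.
  by [].
have sS := span_submodule (map val s).
apply: (big_ind (span _)) => [|x y|i _]; [exact: sub0|exact: subD|].
by apply: subZ => //; apply/mem_span/map_f/mem_nth.
Qed.

Variable V : lmodType R.

(** The coefficients of [x] in elements of [N] form an ideal [J]; finitely many elements of [N]
    realise its generators, and what they leave over lies in [span s], where induction applies. *)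
Lemma sub_span_fingen (s : seq V) (N : set V) : submodule N -> N `<=` span s ->
  exists2 t, (forall x, x \in t -> N x) & N `<=` span t.
Proof.
elim: s N => [|x s IH] N sN Ns; first by exists [::].
have sS := span_submodule s.
pose J : set R^o := [set a | exists2 w, span s w & N ((a : R) *: x + w)].
have sJ : submodule J.
  split=> [|a b [w sw Nw] [w' sw' Nw']|a b [w sw Nw]].
  - by exists 0; [exact: sub0 | rewrite scale0r addr0; apply: sub0].
  - exists (w + w'); first exact: subD.
    by rewrite scalerDl addrACA; apply: subD.
  - exists (a *: w); first exact: subZ.
    by rewrite -scalerA -scalerDr; apply: subZ.
have [js jsJ Jjs] := ideal_span sJ.
have [t1 t1N t1P] : exists2 t1 : seq V, (forall y, y \in t1 -> N y) &
    forall a : R^o, span js a -> exists2 n, span t1 n & span s (n - (a : R) *: x).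
  elim: js jsJ {Jjs} => [|j js IHj] jsJ.
    exists [::] => // a ->; exists 0 => //.
    by rewrite scale0r subr0; apply: sub0.
  have [|t1 t1N t1P] := IHj; first by move=> y ys; apply: jsJ; rewrite in_cons ys orbT.
  have [w sw Nw] := jsJ j (mem_head _ _).
  exists (((j : R) *: x + w) :: t1).
    by move=> y; rewrite in_cons => /orP[/eqP-> //|/t1N].
  move=> a [b [c [jc ->]]]; have [n tn sn] := t1P c jc.
  exists ((b : R) *: ((j : R) *: x + w) + n); first by exists b, n.
  have -> : b *: ((j : R) *: x + w) + n - (b *: j + c : R^o) *: x =
      b *: w + (n - (c : R) *: x).
    rewrite scalerDl -[(b *: j : R^o) *: x]scalerA scalerDr; set p := b *: (j *: x).
    by rewrite opprD addrACA (addrAC p) subrr add0r.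
  by apply: subD => //; apply: subZ.
have [||t2 t2N t2P] := IH (N `&` span s).
- split=> [|u v [Nu su] [Nv sv]|a v [Nv sv]]; split;
    by [exact: sub0 | exact: subD | exact: subZ].
- by move=> v [].
exists (t1 ++ t2) => [y|v Nv].
  by rewrite mem_cat => /orP[/t1N|/t2N[]].
have [a [w [sw vE]]] := Ns v Nv.
have [|n tn sn] := t1P a; first by apply: Jjs; exists w; rewrite -?vE.
have sT := span_submodule (t1 ++ t2).
have Nn : N n by apply: (span_sub _ t1N).
have -> : v = n + (v - n) by rewrite addrC subrK.
apply: subD => //.
  by apply: (span_sub _ _ tn) => // y yt; apply: mem_span; rewrite mem_cat yt.
apply: (span_sub sT (s := t2)).
  by move=> y yt; apply: mem_span; rewrite mem_cat yt orbT.
apply: t2P; split; first exact: subB.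
have -> : v - n = w - (n - a *: x) by rewrite vE opprB addrA [w + _]addrC.
exact: subB.
Qed.

Lemma noetherian_fingen : fingen V -> noetherian_module V.
Proof.
move=> [s sP]; apply: fingen_noetherian_module => N sN.
apply: (@sub_span_fingen s) => // v _.
by have [c ->] := sP v; apply: sum_span.
Qed.

End NoetherianModules.

Lemma noetherian_ring (R : comNzRingType) : noetherian R -> noetherian_module R^o.
Proof. by move=> Rn; apply: fingen_noetherian_module => N /(ideal_span Rn). Qed.

(** * Primes and chains *)

Section Primes.
Variable R : comNzRingType.
Implicit Types (p q P Q : prime_idealr R) (X Y : prime_idealr R -> Prop).

Record prime_set (p : set R^o) : Prop := PrimeSet {
  prime_set_sub : submodule p;
  prime_set1 : ~ p 1;
  prime_setM : forall a b : R, p (a * b) -> p a \/ p b }.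

Lemma prime_idealr_sub p : submodule [set a : R^o | (a : R) \in p].
Proof. by split=> [|a b|a b] /=; [exact: rpred0|exact: rpredD|exact: idealMr]. Qed.

Lemma prime_idealr_set p : prime_set [set a : R^o | (a : R) \in p].
Proof.
split=> [||a b] /=; [exact: prime_idealr_sub|by rewrite idealr1|].
by rewrite prime_idealrM => /orP.
Qed.

Lemma set_prime_idealr (p : set R^o) : prime_set p ->
  exists q : prime_idealr R, forall a, (a \in q) <-> p a.
Proof.
move=> [sp p1 pM].
have c0 : zmod_closed (fun a : R => `[< p a >]).
  split=> [|a b /asboolP Ja /asboolP Jb]; apply/asboolP.
    exact: (sub0 sp).
  exact: (subB sp Ja Jb).
have c1 : let S : {pred R} := fun a => `[< p a >] in
    1 \notin S /\ forall a, {in S, forall u, a * u \in S}.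
  by split=> [|a b /asboolP Jb]; [apply/negP => /asboolP | apply/asboolP; exact: (subZ sp a Jb)].
have c2 : prime_idealr_closed (fun a : R => `[< p a >]).
  by move=> a b /asboolP /pM [] ?; apply/orP; [left|right]; apply/asboolP.
pose m0 := GRing.isZmodClosed.Build R _ c0.
pose m1 := isProperIdeal.Build R _ c1.
pose m2 := isPrimeIdealrClosed.Build R _ c2.
pose I : prime_idealr R := HB.pack (fun a : R => `[< p a >]) m0 m1 m2.
by exists I => a; apply: iff_sym; exact: (rwP (asboolP (p a))).
Qed.

Lemma notin_primeM P (a b : R) : a \notin P -> b \notin P -> a * b \notin P.
Proof. by move=> aP bP; rewrite prime_idealrM negb_or aP. Qed.

Lemma chain_lengths_sub X Y : (forall p, X p -> Y p) ->
  chain_lengths X `<=` chain_lengths Y.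
Proof. by move=> XY n [p [Xp ps]]; exists p; split=> // i /Xp/XY. Qed.

Lemma chain_lengths0 X p : X p -> chain_lengths X 0.
Proof. by move=> Xp; exists (fun=> p). Qed.

Lemma chain_lengths_le X m n : (m <= n)%N ->
  chain_lengths X n -> chain_lengths X m.
Proof.
move=> mn [p [Xp ps]]; exists p; split=> i im; [apply: Xp|apply: ps];
  exact: leq_trans im mn.
Qed.

Lemma chain_lengthsS X p n : X p ->
  chain_lengths (fun q => X q /\ [set` p] `<` [set` q]) n ->
  chain_lengths X n.+1.
Proof.
move=> Xp [r [Xr rs]]; exists (fun i => if i is j.+1 then r j else p).
split=> -[|i] //= ilt; [by have [] := Xr i ilt|by have [] := Xr 0%N isT|exact: rs].
Qed.

Lemma chain_sub (p : nat -> prime_idealr R) n :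
  (forall i, (i < n)%N -> [set` p i] `<` [set` p i.+1]) ->
  forall i j, (i <= j)%N -> (j <= n)%N -> {subset p i <= p j}.
Proof.
move=> ps i; elim=> [|j IH]; first by rewrite leqn0 => /eqP-> _ a.
rewrite leq_eqVlt => /orP[/eqP-> _ a //|ij] jn a /(IH ij (ltnW jn)) aj.
by have [+ _] := ps j jn; apply.
Qed.

(** The term [r 0] is dropped: since [p k] lies in [P], which lies in [r 0], the step from [p k] to
    [r 1] is strict and no length is lost even when [p k], [P] and [r 0] coincide. *)
Lemma chain_lengths_cat X P k c :
  (forall q r : prime_idealr R, X q -> {subset q <= r} -> X r) ->
  chain_lengths (fun q => X q /\ {subset q <= P}) k ->
  chain_lengths (fun q => {subset P <= q}) c ->
  chain_lengths X (k + c).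
Proof.
move=> Xup [p [Xp ps]] [r [Pr rs]].
exists (fun i => if (i <= k)%N then p i else r (i - k)%N).
have [Xpk pkP] := Xp k (leqnn k).
split=> i ilt.
  case: leqP => [/Xp[]//|ki]; apply: (Xup _ _ Xpk) => a /pkP; apply: Pr.
  by rewrite leq_subLR.
have [ik|ki] := leqP i.+1 k; first by rewrite (ltnW ik); apply: ps.
rewrite ltnS in ki; have [ik|ki'] := leqP i k.
  have -> : i = k by apply/eqP; rewrite eqn_leq ik.
  rewrite subSnn; have [|r01 r10] := rs 0%N.
    by rewrite -(ltn_add2l k) addn0 (leq_ltn_trans ki).
  split=> [a /pkP ap|r1p]; first exact/r01/Pr.
  by apply: r10 => a /r1p/pkP; apply: Pr.
by rewrite subSn //; apply: rs; rewrite ltn_subLR.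
Qed.

(* [a + z] avoids the last prime [p] and every prime below it as soon as [z] does
   and [a] does not; the primes [q] not below [p] are handled by taking [z] in [q]. *)
Lemma prime_avoidance (T : eqType) (s : seq T) (p : T -> set R^o) (I : set R^o) :
  submodule I -> (forall t, t \in s -> prime_set (p t)) ->
  (forall t, t \in s -> exists2 a, I a & ~ p t a) ->
  exists2 a, I a & forall t, t \in s -> ~ p t a.
Proof.
move=> sI; elim: s => [|t s IH] pr av; first by exists 0; [exact: sub0|].
have [||a Ia aP] := IH.
- by move=> t' ts; apply: pr; rewrite in_cons ts orbT.
- by move=> t' ts; apply: av; rewrite in_cons ts orbT.
have [pta|npta] := pselect (p t a); last first.
  by exists a => // t'; rewrite in_cons => /orP[/eqP->|/aP].
have prt := pr t (mem_head _ _).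
have [z Iz [ptz zs]] : exists2 z, I z & ~ p t z /\
    forall t', t' \in s -> ~ p t' `<=` p t -> p t' z.
  have {IH aP} : forall t', t' \in s -> prime_set (p t').
    by move=> t' ts; apply: pr; rewrite in_cons ts orbT.
  elim: s {pr av} (av t (mem_head _ _)) => [|t' s IH] [y Iy ty] pr.
    by exists y.
  have [||z Iz [ptz zs]] := IH.
  - by exists y.
  - by move=> t'' ts; apply: pr; rewrite in_cons ts orbT.
  have [sub|/existsNP[c /not_implyP[pc ptc]]] := pselect (p t' `<=` p t).
    by exists z => //; split=> // t''; rewrite in_cons => /orP[/eqP->|/zs].
  exists (c * z); first exact: (subZ sI).
  split=> [/(prime_setM prt)[]//|t'']; rewrite in_cons => /orP[/eqP->|ts] ns.
    have -> : c * z = z * c by rewrite mulrC.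
    exact: (subZ (prime_set_sub (pr t' (mem_head _ _))) z pc).
  apply: (subZ (prime_set_sub (pr t'' _))); first by rewrite in_cons ts orbT.
  exact: zs.
exists (a + z); first exact: subD.
have ptaz : ~ p t (a + z) by move=> /(subDr (prime_set_sub prt) pta).
move=> t'; rewrite in_cons => /orP[/eqP-> //|ts] pt'.
have [sub|nsub] := pselect (p t' `<=` p t); first by apply: ptaz; apply: sub.
have sp : submodule (p t') by apply: prime_set_sub; apply: pr; rewrite in_cons ts orbT.
by apply: (aP t' ts); apply: (subDr sp (zs t' ts nsub)); rewrite addrC.
Qed.

Hypothesis Rn : noetherian_module R^o.

Lemma exists_maximal (J : set R^o) : submodule J -> ~ J 1 ->
  exists Q, maximal Q /\ forall a, J a -> a \in Q.
Proof.
move=> sJ J1; pose F := [set K : set R^o | [/\ submodule K, ~ K 1 & J `<=` K]].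
have [||K [sK K1 JK] Kmax] := Rn (F := F); [by move=> K []|by exists J; split|].
have pK : prime_set K.
  split=> // a b Kab; have [Ka|nKa] := pselect (K a); [by left|right].
  pose L : set R^o := [set c | exists x y : R^o, K x /\ c = x + y * a].
  have sL : submodule L.
    split=> [|_ _ [x [y [Kx ->]]] [x' [y' [Kx' ->]]]|r _ [x [y [Kx ->]]]].
    - by exists 0, 0; rewrite mul0r addr0; split=> //; apply: sub0.
    - by exists (x + x'), (y + y'); rewrite mulrDl addrACA; split=> //; apply: subD.
    - exists (r *: x), (r * y); rewrite scalerDr -mulrA; split=> //; exact: subZ.
  have KL : K `<=` L by move=> x Kx; exists x, 0; rewrite mul0r addr0.
  (* [L] is $K + Ra$. If $1 = x + ya$, then $b = bx + y(ab)$ lies in [K]; otherwise maximality puts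
     [a] into [K]. *)
  have [[x [y [Kx E]]]|nL1] := pselect (L 1).
    have -> : b = b * x + y * (a * b) :> R.
      by rewrite mulrA [_ * b]mulrC -mulrDr -E mulr1.
    exact: (subD sK (subZ sK b Kx) (subZ sK y Kab)).
  case: nKa; apply: (Kmax L) => //.
    by split=> //; apply: subset_trans KL.
  by exists 0, 1; rewrite mul1r add0r; split=> //; apply: sub0.
have [Q QK] := set_prime_idealr pK; exists Q; split=> [I QI a aI|a /JK/QK//].
apply/QK; apply: (Kmax [set b : R^o | (b : R) \in I]) => //=.
  split=> [||b Jb] /=; last exact/QI/QK/JK.
  - by split=> [|b c|b c] /=; [exact: rpred0|exact: rpredD|exact: idealMr].
  - by rewrite idealr1.
by move=> b /QK/QI.
Qed.

End Primes.

(** * Local regular sequences *)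

Section LocalRegularity.
Variables (R : comNzRingType) (W : lmodType R).
Hypotheses (Rn : noetherian_module R^o) (Wn : noetherian_module W).
Implicit Types (N K : set W) (p q P Q I : prime_idealr R).

(* The preimage in [W] of the localization [N_P]. Local notions are expressed on [W]
   itself, which makes different primes comparable. *)
Definition sat P N : set W := [set v | exists2 s, s \notin P & N (s *: v)].

Definition colon N v : set R^o := [set a | N ((a : R) *: v)].

(** As [sat p N] is the preimage of $N_p$, this is the support of $W/N$. *)
Definition suppN N p := exists v, ~ sat p N v.

(** $N + xW$: the quotient of $W/N$ by [x] is again a quotient of [W], and only the submodule
    changes. *)
Definition addmul (x : R) N : set W :=
  [set v | exists u w, N u /\ v = u + x *: w].

(* [x / 1] is a nonzerodivisor on [(W / N)_P]. *)
Definition regular P N x := forall v, sat P N (x *: v) -> sat P N v.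

(* [(W / N)_P] has a regular sequence of length [n] with terms in [I]. *)
Fixpoint grade_ge P I n N : Prop :=
  if n is n'.+1 then
    exists x, [/\ x \in I, regular P N x & grade_ge P I n' (addmul x N)]
  else True.

(* [(W / N)_P] is Cohen-Macaulay over [R_P]. *)
Definition cmat P N := exists n,
  [/\ chain_lengths (fun q => suppN N q /\ {subset q <= P}) n,
      (forall k, chain_lengths (fun q => suppN N q /\ {subset q <= P}) k ->
         (k <= n)%N)
    & grade_ge P P n N].

Lemma sub_sat P N : N `<=` sat P N.
Proof. by move=> v Nv; exists 1; rewrite ?idealr1 ?scale1r. Qed.

Lemma sat_submodule P N : submodule N -> submodule (sat P N).
Proof.
move=> sN; split=> [|u v [s sP Nu] [t tP Nv]|a v [s sP Nv]].
- by apply: sub_sat; apply: sub0.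
- exists (s * t); first exact: notin_primeM.
  rewrite scalerDr {1}mulrC -!scalerA.
  by apply: subD => //; apply: subZ.
- by exists s => //; rewrite scaleCA; apply: subZ.
Qed.

Lemma sat_mono P Q N : {subset P <= Q} -> sat Q N `<=` sat P N.
Proof. by move=> PQ v [s sQ Nv]; exists s => //; apply: contraNN sQ => /PQ. Qed.

Lemma sat_sub P N K : N `<=` K -> sat P N `<=` sat P K.
Proof. by move=> NK v [s sP /NK Kv]; exists s. Qed.

Lemma satZ P N s v : s \notin P -> sat P N (s *: v) -> sat P N v.
Proof.
move=> sP [t tP]; rewrite scalerA => Nv; exists (t * s) => //.
exact: notin_primeM.
Qed.

Lemma sat_sat P N : sat P (sat P N) `<=` sat P N.
Proof. by move=> v [s sP /(satZ sP)]. Qed.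

Lemma suppN_up N p q : suppN N p -> {subset p <= q} -> suppN N q.
Proof. by move=> [v nv] pq; exists v => /(sat_mono pq). Qed.

Lemma colon_submodule N v : submodule N -> submodule (colon N v).
Proof.
move=> sN; split=> [|a b Na Nb|a b Nb]; rewrite /colon /=.
- by rewrite scale0r; apply: sub0.
- by rewrite scalerDl; apply: subD.
- by rewrite -scalerA; apply: subZ.
Qed.

Lemma addmul_submodule x N : submodule N -> submodule (addmul x N).
Proof.
move=> sN; split=> [|_ _ [u [w [Nu ->]]] [u' [w' [Nu' ->]]]|a _ [u [w [Nu ->]]]].
- by exists 0, 0; rewrite scaler0 addr0; split=> //; apply: sub0.
- by exists (u + u'), (w + w'); rewrite scalerDr addrACA; split=> //; apply: subD.
- exists (a *: u), (a *: w); rewrite scalerDr !scalerA mulrC; split=> //.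
  exact: subZ.
Qed.

Lemma sub_addmul x N : N `<=` addmul x N.
Proof. by move=> v Nv; exists v, 0; rewrite scaler0 addr0. Qed.

Lemma addmul_mul x N w : submodule N -> addmul x N (x *: w).
Proof. by move=> sN; exists 0, w; rewrite add0r; split=> //; apply: sub0. Qed.

Lemma addmulC x y N : addmul x (addmul y N) = addmul y (addmul x N).
Proof.
suff sub a b : addmul a (addmul b N) `<=` addmul b (addmul a N).
  by apply/seteqP; split; apply: sub.
move=> _ [_ [w [[u [w' [Nu ->]]] ->]]]; exists (u + a *: w), w'.
by rewrite addrAC; split=> //; exists u, w.
Qed.

(** A maximal annihilator is prime. Only multiples of [v] outside the saturation compete, which
    forces the prime into [P]. If $y$ sends $bv$ into the saturation, some $s \notin P$ makes $y$
    kill $s(bv)$, still a competitor, so maximality puts $y$ into the annihilator of $bv$. *)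
Lemma exists_assoc P N v : submodule N -> ~ sat P N v ->
  exists b p, {subset p <= P} /\ forall a, (a \in p) <-> N (a *: (b *: v)).
Proof.
move=> sN nv.
pose F := [set J | exists b, J = colon N (b *: v) /\ ~ sat P N (b *: v)].
have [||J [b [-> nb]] Jmax] := Rn (F := F).
- by move=> _ [b [-> _]]; apply: colon_submodule.
- by exists (colon N (1 *: v)), 1; rewrite scale1r.
have sub r : ~ sat P N (r *: (b *: v)) ->
    colon N (r *: (b *: v)) `<=` colon N (b *: v).
  move=> nr; apply: Jmax; first by exists (r * b); rewrite -scalerA; split.
  by move=> a Na; rewrite /colon /= scaleCA; apply: subZ.
have pP : prime_set (colon N (b *: v)).
  split; first exact: colon_submodule.
    by rewrite /colon /= scale1r => h; apply: nb; apply: sub_sat.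
  move=> x y; rewrite {1}/colon /= -scalerA => Nxy.
  have [Ny|ny] := pselect (sat P N (y *: (b *: v))); last by left; apply: (sub y).
  right; have [s sP] := Ny; rewrite scaleCA => Nsy.
  by apply: (sub s) => // /(satZ sP).
have [p pE] := set_prime_idealr pP; exists b, p; split=> // a /pE Na.
by apply: contrapT => /negP aP; apply: nb; exists a.
Qed.

Lemma exists_prime_over N v : submodule N -> ~ N v ->
  exists P, forall a, N (a *: v) -> a \in P.
Proof.
move=> sN nv; have [|Q [_ QP]] := exists_maximal Rn (colon_submodule v sN).
  by rewrite /colon /= scale1r.
by exists Q.
Qed.

Lemma exists_assoc_set N v : submodule N -> ~ N v ->
  exists b, prime_set (colon N (b *: v)).
Proof.
move=> sN nv; have [P vP] := exists_prime_over sN nv.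
have [|b [p [_ pE]]] := @exists_assoc P N v sN.
  by move=> [s sP /vP]; apply/negP.
exists b; suff -> : colon N (b *: v) = [set a : R^o | (a : R) \in p].
  exact: prime_idealr_set.
by apply/seteqP; split=> a /pE.
Qed.

(** Noetherian induction on a submodule [K] whose prime annihilators modulo [N] are covered by
    finitely many. If [K] is proper, adjoining one [w] with $(K : w)$ prime creates at most that one
    new prime. *)
Lemma finite_assoc N : submodule N ->
  exists2 ws : seq W, forall w, w \in ws -> prime_set (colon N w) &
    forall a v, ~ N v -> N (a *: v) -> exists2 w, w \in ws & N (a *: w).
Proof.
move=> sN.
pose covers (ws : seq W) K := forall u, K u -> prime_set (colon N u) ->
  exists2 w, w \in ws & colon N u `<=` colon N w.
pose F := [set K | [/\ submodule K, N `<=` K & exists2 ws : seq W,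
  forall w, w \in ws -> prime_set (colon N w) & covers ws K]].
have [||K [sK NK [ws wsP wsK]] Kmax] := Wn (F := F); first by move=> K [].
  exists N; split=> //; exists [::] => // u Nu /prime_set1.
  by rewrite /colon /= scale1r.
suff Kall v : K v.
  exists ws => // a v nv Nav; have [b pb] := exists_assoc_set sN nv.
  have [w wws sub] := wsK (b *: v) (Kall _) pb; exists w => //.
  by apply: sub; rewrite /colon /= scaleCA; apply: subZ.
apply: contrapT => nKv; have [b] := exists_assoc_set sK nKv.
set w := b *: v => pw.
pose K' := [set u | exists k a, K k /\ u = k + a *: w].
have sK' : submodule K'.
  split=> [|_ _ [u [a [Ku ->]]] [u' [a' [Ku' ->]]]|c _ [u [a [Ku ->]]]].
  - by exists 0, 0; rewrite scale0r addr0; split=> //; apply: sub0.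
  - by exists (u + u'), (a + a'); rewrite scalerDl addrACA; split=> //; apply: subD.
  - exists (c *: u), (c * a); rewrite scalerDr scalerA; split=> //; exact: subZ.
have KK' : K `<=` K' by move=> u Ku; exists u, 0; rewrite scale0r addr0.
have K'w : K' w by exists 0, 1; rewrite scale1r add0r; split=> //; apply: sub0.
suff FK' : F K'.
  apply: (prime_set1 pw); rewrite /colon /= scale1r.
  exact: Kmax FK' KK' _ K'w.
split=> //; first exact: subset_trans KK'.
(* A multiple of [u] that lies in [K] but not in [N] has the same prime annihilator as [u], so [K]
   already covers it. If there is none, $ru \in N$ amounts to $ru \in K$, that is to $rw \in K$. *)
have covK' u : K' u -> prime_set (colon N u) ->
    (exists2 w', w' \in ws & colon N u `<=` colon N w') \/
    colon N u = colon K w.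
  move=> [k [a [Kk uE]]] pu.
  have [Kaw|nKaw] := pselect (K (a *: w)).
    by left; apply: wsK => //; rewrite uE; apply: subD.
  have [[c Kcu nNcu]|nc] := pselect (exists2 c, K (c *: u) & ~ N (c *: u)).
    have cE : colon N (c *: u) = colon N u.
      apply/seteqP; split=> r; rewrite /colon /= => Nr.
        have : colon N u (r * c) by rewrite /colon /= -scalerA.
        by case/(prime_setM pu).
      by rewrite scaleCA; apply: subZ.
    by left; rewrite -cE; apply: wsK; rewrite ?cE.
  right; apply/seteqP; split=> r; rewrite /colon /=.
    move/NK; rewrite uE scalerDr => /(subDr sK (subZ sK r Kk)).
    have := prime_setM pw (a := r) (b := a); rewrite /colon /= -scalerA.
    by move=> h /h[].
  move=> Krw; apply: contrapT => nNru; apply: nc; exists r => //.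
  rewrite uE scalerDr; apply: subD; [by []|exact: subZ|].
  by rewrite scaleCA; apply: subZ.
(* The candidate prime $(K : w)$ is added only when it is realised as an annihilator modulo [N]. *)
have [[u0 u0E]|nu0] := pselect (exists u0, colon N u0 = colon K w).
  exists (u0 :: ws) => [w'|u K'u pu].
    by rewrite in_cons => /orP[/eqP->|/wsP//]; rewrite u0E.
  have [[w' w's sub]|uE] := covK' u K'u pu.
    by exists w' => //; rewrite in_cons w's orbT.
  by exists u0; rewrite ?mem_head // uE u0E.
exists ws => // u K'u pu; have [//|uE] := covK' u K'u pu.
by case: nu0; exists u.
Qed.

(** Prime avoidance against the associated primes of all the quotients at once. None of them
    contains [I], since [I] would then kill a nonzero class. *)
Lemma common_regular I (Ns : seq (set W)) :
  (forall i, (i < size Ns)%N -> submodule (nth set0 Ns i) /\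
    forall v, (forall a, a \in I -> nth set0 Ns i (a *: v)) -> nth set0 Ns i v) ->
  exists2 x, x \in I & forall i, (i < size Ns)%N ->
    forall v, nth set0 Ns i (x *: v) -> nth set0 Ns i v.
Proof.
move=> NsP.
have [s sP sI] : exists2 s : seq (nat * W),
    (forall t, t \in s -> (t.1 < size Ns)%N /\
       prime_set (colon (nth set0 Ns t.1) t.2)) &
    forall i a v, (i < size Ns)%N -> ~ nth set0 Ns i v -> nth set0 Ns i (a *: v) ->
      exists2 t, t \in s & nth set0 Ns t.1 (a *: t.2).
  have : forall k, (k <= size Ns)%N -> exists2 s : seq (nat * W),
      (forall t, t \in s -> (t.1 < size Ns)%N /\
         prime_set (colon (nth set0 Ns t.1) t.2)) &
      forall i a v, (i < k)%N -> ~ nth set0 Ns i v -> nth set0 Ns i (a *: v) ->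
        exists2 t, t \in s & nth set0 Ns t.1 (a *: t.2).
    elim=> [|k IH] kN; first by exists [::].
    have [s sP sI] := IH (ltnW kN); have [sk _] := NsP k kN.
    have [ws wsP wsI] := finite_assoc sk.
    exists ([seq (k, w) | w <- ws] ++ s).
      move=> t; rewrite mem_cat => /orP[/mapP[w /wsP pw ->]|/sP]; by [].
    move=> i a v; rewrite ltnS leq_eqVlt => /orP[/eqP->|ik] nv Nav.
      have [w wws Naw] := wsI a v nv Nav; exists (k, w) => //.
      by rewrite mem_cat map_f.
    by have [t ts] := sI i a v ik nv Nav; exists t; rewrite // mem_cat ts orbT.
  exact.
have [|t /sP[]//|t /sP[tN pt]|x xI xP] := @prime_avoidance R _ s
    (fun t => colon (nth set0 Ns t.1) t.2) [set a : R^o | (a : R) \in I].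
- exact: prime_idealr_sub.
- apply: contrapT => h; apply: (prime_set1 pt); rewrite /colon /= scale1r.
  apply: (NsP t.1 tN).2 => a aI; apply: contrapT => na; apply: h.
  by exists a.
exists x => // i iN v Nxv; apply: contrapT => nv.
by have [t /xP] := sI i x v iN nv Nxv.
Qed.

(** Up to denominators and modulo [N], let $xa = wb$. Then $b = xc$, because [w] is regular modulo
    $N + xW$, and cancelling [x] gives $a = wc$. *)
Lemma regular_addmul P N x w : submodule N -> regular P N w ->
  regular P N x -> regular P (addmul x N) w -> regular P (addmul w N) x.
Proof.
move=> sN rw rx rxw a [s sP [n [b [Nn E]]]].
have [t tP [n' [c [Nn' E']]]] : sat P (addmul x N) b.
  apply: rxw; exists 1; rewrite ?idealr1 // scale1r.
  exists (- n), (s *: a); split; first exact: subN.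
  by rewrite [x *: _]scaleCA E addKr.
have [r rP Nr] : sat P N ((t * s) *: a - w *: c).
  apply: rx; apply: sub_sat.
  have -> : x *: ((t * s) *: a - w *: c) = t *: n + w *: n'.
    rewrite scalerBr !scalerA.
    have -> : x * (t * s) = t * (s * x) by ring.
    rewrite -[(t * (s * x)) *: a]scalerA -[(s * x) *: a]scalerA E scalerDr.
    rewrite [t *: (w *: b)]scalerA [t * w]mulrC -[(w * t) *: b]scalerA E'.
    by rewrite scalerDr [w *: (x *: c)]scalerA [w * x]mulrC addrA addrK.
  by apply: subD => //; apply: subZ.
exists (r * (t * s)); first by do 2?apply: notin_primeM.
exists (r *: ((t * s) *: a - w *: c)), (r *: c); split=> //.
by rewrite scalerBr !scalerA [r * w]mulrC subrK.
Qed.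

(** After localization, $\mathrm{Hom}(R/I, W/(N + xW))$ is $\mathrm{Ext}^1(R/I, W/N)$ for every
    regular [x] in [I]. Concretely [u] is sent to [v] with $zu = xv$ modulo [N]: cancelling [z]
    shows that [v] is nonzero, cancelling [x] that [I] kills it. *)
Lemma killed_addmul P I N x z : submodule N -> x \in I -> z \in I ->
  regular P N x -> regular P N z ->
  (exists2 u, ~ sat P (addmul x N) u &
     forall c, c \in I -> sat P (addmul x N) (c *: u)) ->
  (exists2 v, ~ sat P (addmul z N) v &
     forall c, c \in I -> sat P (addmul z N) (c *: v)).
Proof.
move=> sN xI zI rx rz [u nu Iu]; have [s sP [n [v [Nn E]]]] := Iu z zI.
exists v => [[t tP [n' [w [Nn' E']]]]|c cI].
  have [r rP Nr] : sat P N ((t * s) *: u - x *: w).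
    apply: rz; apply: sub_sat.
    have -> : z *: ((t * s) *: u - x *: w) = t *: n + x *: n'.
      rewrite scalerBr !scalerA.
      have -> : z * (t * s) = t * (s * z) by ring.
      rewrite -[(t * (s * z)) *: u]scalerA -[(s * z) *: u]scalerA E scalerDr.
      rewrite [t *: (x *: v)]scalerA [t * x]mulrC -[(x * t) *: v]scalerA E'.
      by rewrite scalerDr [x *: (z *: w)]scalerA [x * z]mulrC addrA addrK.
    by apply: subD => //; apply: subZ.
  apply: nu; exists (r * (t * s)); first by do 2?apply: notin_primeM.
  exists (r *: ((t * s) *: u - x *: w)), (r *: w); split=> //.
  by rewrite scalerBr !scalerA [r * x]mulrC subrK.
have [t tP [n' [y [Nn' E']]]] := Iu c cI.
have [r rP Nr] : sat P N ((t * c) *: v - (s * z) *: y).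
  apply: rx; apply: sub_sat.
  have -> : x *: ((t * c) *: v - (s * z) *: y) = (s * z) *: n' - (t * c) *: n.
    have -> : x *: ((t * c) *: v - (s * z) *: y) =
        (t * c) *: (x *: v) - (s * z) *: (x *: y).
      by rewrite scalerBr !scalerA; congr (_ *: _ - _ *: _); ring.
    have -> : x *: v = s *: (z *: u) - n by rewrite E addrAC subrr add0r.
    have -> : x *: y = t *: (c *: u) - n' by rewrite E' addrAC subrr add0r.
    have E1 : (t * c) *: (s *: (z *: u)) = (s * z) *: (t *: (c *: u)).
      by rewrite !scalerA; congr (_ *: _); ring.
    by rewrite !scalerBr E1 opprB addrC addrA subrK.
  by apply: subB => //; apply: subZ.
exists (r * t); first exact: notin_primeM.
exists (r *: ((t * c) *: v - (s * z) *: y)), ((r * s) *: y); split=> //.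
by rewrite scalerBr !scalerA -!mulrA [z * (r * s)]mulrCA [z * s]mulrC subrK.
Qed.

(* Choosing [w] regular modulo each of [N], [N + xW] and [N + zW], one passes from
   [x] to [z] through [w], using that two regular elements may be swapped. *)
Lemma grade_exchange P I n N z : submodule N -> grade_ge P I n.+1 N ->
  z \in I -> regular P N z -> grade_ge P I n (addmul z N).
Proof.
elim: n N z => [//|n IH] N z sN [x [xI rx [x2 [x2I rx2 gx2]]]] zI rz.
have sx := addmul_submodule x sN; have sz := addmul_submodule z sN.
have [|w wI wP] := @common_regular I
    [:: sat P N; sat P (addmul x N); sat P (addmul z N)].
  move=> [|[|[|//]]] _ /=; split; try exact: sat_submodule.
  - by move=> v Iv; apply: rx; apply: Iv.
  - by move=> v Iv; apply: rx2; apply: Iv.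
  (* A class killed by [I] modulo $N + zW$ would give one modulo $N + xW$, where [x2] is regular. *)
  - move=> v Iv; apply: contrapT => nv.
    have [|u nu Iu] := @killed_addmul P I N z x sN zI xI rz rx; first by exists v.
    by apply: nu; apply: rx2; apply: Iu.
have rw : regular P N w by move=> v; apply: (wP 0%N).
have rwx : regular P (addmul x N) w by move=> v; apply: (wP 1%N).
have rwz : regular P (addmul z N) w by move=> v; apply: (wP 2%N).
have gw : grade_ge P I n.+1 (addmul w N).
  exists x; split=> //; first exact: regular_addmul.
  by rewrite addmulC; apply: IH => //; exists x2.
exists w; split=> //; rewrite addmulC; apply: IH => //.
- exact: addmul_submodule.
- exact: regular_addmul.
Qed.

(* Nakayama's lemma for [x]-divisible submodules: choose [N + Ru] maximal. *)
Lemma divisible_sat P N x (K : set W) : submodule N -> x \in P ->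
  (forall u, K u -> exists s u', [/\ s \notin P, K u' & N (s *: u - x *: u')]) ->
  K `<=` sat P N.
Proof.
move=> sN xP divK v Kv; apply: contrapT => nv.
pose E u := [set y | exists2 s, s \notin P & exists a, N (s *: y - a *: u)].
have sE u : submodule (E u).
  split=> [|y y' [s sP [a Na]] [s' sP' [a' Na']]|c y [s sP [a Na]]].
  - by exists 1; rewrite ?idealr1 //; exists 0; rewrite scaler0 scale0r subr0; apply: sub0.
  - exists (s * s'); first exact: notin_primeM.
    exists (s' * a + s * a').
    have -> : (s * s') *: (y + y') - (s' * a + s * a') *: u =
        s' *: (s *: y - a *: u) + s *: (s' *: y' - a' *: u).
      by rewrite !scalerBr !scalerA scalerDr scalerDl opprD addrACA [s' * s]mulrC.
    by apply: subD => //; apply: subZ.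
  - exists s => //; exists (c * a).
    have -> : s *: (c *: y) - (c * a) *: u = c *: (s *: y - a *: u).
      by rewrite scalerBr !scalerA [s * c]mulrC.
    exact: subZ.
pose F := [set L | exists u, [/\ L = E u, K u & ~ sat P N u]].
have [||L [u [-> Ku nu]] Lmax] := Wn (F := F).
- by move=> _ [u [-> _ _]].
- by exists (E v), v.
have [s [u' [sP Ku' Nu']]] := divK u Ku.
have nu' : ~ sat P N u'.
  move=> [t tP Nt]; apply: nu; exists (t * s); first exact: notin_primeM.
  have -> : (t * s) *: u = t *: (s *: u - x *: u') + x *: (t *: u').
    by rewrite scalerBr !scalerA [x * t]mulrC subrK.
  by apply: subD => //; apply: subZ.
have EE : E u `<=` E u'.
  move=> y [t tP [a Na]]; exists (s * t); first exact: notin_primeM.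
  exists (a * x).
  have -> : (s * t) *: y - (a * x) *: u' =
      s *: (t *: y - a *: u) + a *: (s *: u - x *: u').
    by rewrite !scalerBr !scalerA [a * s]mulrC addrA subrK.
  by apply: subD => //; apply: subZ.
have [t tP [a Na]] : E u u'.
  apply: (Lmax (E u')) => //; first by exists u'.
  exists 1; rewrite ?idealr1 //; exists 1.
  by rewrite subrr; apply: sub0.
(* Modulo [N], maximality gives $tu' = au$, while $su = xu'$; so $st - ax$ kills $u'$, and it is
   outside [P] because [x] is inside. *)
apply: nu'; exists (s * t - a * x).
  apply/negP => h; have := notin_primeM sP tP; apply/negP/negPn.
  by rewrite -(subrK (a * x) (s * t)) rpredD // idealMr.
have -> : (s * t - a * x) *: u' = s *: (t *: u' - a *: u) + a *: (s *: u - x *: u').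
  rewrite !scalerBr !scalerA [a * s]mulrC addrA subrK scalerBl.
  by [].
by apply: subD => //; apply: subZ.
Qed.

(* An element killed by [p] but not divisible by the first term [x] yields an
   associated prime of [W / (N + xW)] that strictly contains [p]. *)
Lemma grade_chain P n N p v : submodule N -> grade_ge P P n N ->
  {subset p <= P} -> (forall a, (a \in p) <-> sat P N (a *: v)) ->
  chain_lengths (fun q => {subset p <= q} /\ {subset q <= P}) n.
Proof.
elim: n N p v => [|n IH] N p v sN.
  by move=> _ pP _; apply: (@chain_lengths0 _ _ p); split=> // a.
move=> [x [xP rx gx]] pP pE.
have sx := addmul_submodule x sN.
pose K := [set u | forall a, a \in p -> sat P N (a *: u)].
have nv : ~ sat P N v.
  by move=> h; have := idealr1 p; rewrite (pE 1).2 // scale1r.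
(* Otherwise [K] would be divisible by [x], with quotients again in [K] since [x] is regular, and
   Nakayama's lemma would put [v] into the saturation of [N]. *)
have [u Ku nu] : exists2 u, K u & ~ sat P (addmul x N) u.
  apply: contrapT => h.
  have sub : K `<=` sat P (addmul x N).
    by move=> u Ku; apply: contrapT => nu; apply: h; exists u.
  apply: nv; suff : K `<=` sat P N by apply; move=> a /pE.
  apply: (divisible_sat sN xP) => u Ku; have [s sP [y [w [Ny E]]]] := sub u Ku.
  exists s, w; split=> // [a ap|]; last by rewrite E addrK.
  apply: rx; have -> : x *: (a *: w) = s *: (a *: u) - a *: y.
    apply/eqP; rewrite eq_sym subr_eq !scalerA [s * a]mulrC [x * a]mulrC -!scalerA.
    by rewrite -scalerDr E addrC.
  apply: subB; first exact: sat_submodule.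
    by apply: subZ; [exact: sat_submodule|exact: Ku].
  by apply: sub_sat; apply: subZ.
(* The prime is taken over the saturated submodule, so that [qE] is already the local condition
   expected by the induction hypothesis. *)
have [||b [q [_ qE]]] := @exists_assoc P (sat P (addmul x N)) u.
- exact: sat_submodule.
- by move=> /sat_sat.
have qP : {subset q <= P}.
  move=> a /qE h; apply: contrapT => /negP aP.
  have := satZ aP h; rewrite -[b *: u]scale1r => /qE.
  by rewrite idealr1.
have sS := sat_submodule P sx.
have pq : {subset p <= q}.
  move=> a ap; apply/qE; rewrite scaleCA.
  apply: subZ => //; apply: sat_sub (Ku a ap); exact: sub_addmul.
apply: (@chain_lengthsS _ _ p); first by split=> // a.
apply: chain_lengths_sub (IH _ q (b *: u) sx gx qP qE) => r [qr rP].
split; first by split=> // a /pq/qr.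
split=> [a /pq/qr//|rp].
(* Strictness: [x] lies in [q], and it cannot lie in [p] because it is regular while [v] is outside
   the saturation. *)
have /pE/rx // : x \in p.
by apply/rp/qr/qE/sub_sat/addmul_mul.
Qed.

(** If [P] killed a nonzero class, it would lie in an associated prime, above which [grade_chain]
    gives a chain longer than [c]. So [P] contains a regular element, and [grade_exchange] makes it
    the first term; this repeats while the remaining length exceeds [c]. *)
Lemma grade_descent P Q m c N : submodule N -> {subset P <= Q} ->
  (forall k, chain_lengths (fun q => {subset P <= q} /\ {subset q <= Q}) k ->
     (k <= c)%N) ->
  grade_ge Q Q m N -> grade_ge Q P (m - c) N.
Proof.
move=> sN PQ cmax; elim: m N sN => [//|m IH] N sN gN.
have [mc|cm] := leqP m.+1 c; first by rewrite (eqP mc).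
rewrite subSn //.
have [|y yP /(_ 0%N isT) ry] := @common_regular P [:: sat Q N].
  move=> [|//] _ /=; split; first exact: sat_submodule.
  move=> v Pv; apply: contrapT => nv.
  have [||b [q [qQ qE]]] := @exists_assoc Q (sat Q N) v.
  - exact: sat_submodule.
  - by move=> /sat_sat.
  have /cmax : chain_lengths (fun r => {subset P <= r} /\ {subset r <= Q}) m.+1.
    apply: chain_lengths_sub (grade_chain sN gN qQ qE) => r [qr rQ]; split=> //.
    move=> a aP; apply/qr/qE; rewrite scaleCA.
    by apply: subZ; [exact: sat_submodule|exact: Pv].
  by rewrite leqNgt cm.
exists y; split=> //; apply: IH; first exact: addmul_submodule.
by apply: grade_exchange => //; apply: PQ.
Qed.

Lemma grade_localize P Q I n N : submodule N -> {subset P <= Q} ->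
  grade_ge Q I n N -> grade_ge P I n N.
Proof.
move=> sN PQ; elim: n N sN => //= n IH N sN [x [xI rx gx]].
exists x; split=> //; last by apply: IH => //; apply: addmul_submodule.
move=> v [s sP]; rewrite scaleCA => /(@sub_sat Q)/rx.
by move=> /(sat_mono PQ)/(satZ sP).
Qed.

End LocalRegularity.

(** * Supports and the dimension filtration *)

Section Supports.
Local Open Scope quotient_scope.
Variable R : comNzRingType.
Implicit Types (V : lmodType R) (p : prime_idealr R).

Lemma submod_ext V (N K : submodClosed V) : N =i K -> N = K.
Proof.
case: N K => [N cN] [K cK] /= /funext NK.
have {}NK : N = K by exact: NK.
case: K / NK cK => cK; congr GRing.SubmodClosed.Pack.
case: cN cK => [[c1] [c2]] [[c1'] [c2']].
by rewrite (Prop_irrelevance c1 c1') (Prop_irrelevance c2 c2').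
Qed.

Lemma prime_ext (p q : prime_idealr R) : p =i q -> p = q.
Proof.
case: p q => [p cp] [q cq] /= /funext pq.
have {}pq : p = q by exact: pq.
case: q / pq cq => cq; congr PrimeIdealr.Pack.
case: cp cq => [[c1] [c2] [c3] [c4]] [[c1'] [c2'] [c3'] [c4']].
by rewrite (Prop_irrelevance c1 c1') (Prop_irrelevance c2 c2')
  (Prop_irrelevance c3 c3') (Prop_irrelevance c4 c4').
Qed.

Lemma lfrac_eq0 p V (v : V) (s : denom p) :
  lfrac v s = 0 <-> sat p [set 0] v.
Proof.
rewrite -lfrac0 lfracP; split=> [[u]|[u uP /= uv]].
  by rewrite !scaler0 scale1r => uv; exists (dval u) => //; exact: valP u.
by exists (Denom uP); rewrite /= !scaler0 scale1r.
Qed.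

Lemma supp_suppN V p : supp V p <-> suppN [set (0 : V)] p.
Proof.
split=> [[x]|[v nv]].
  have [v [s ->]] := lfracE x => /eqP nv; exists v => sv.
  by apply/nv/lfrac_eq0.
by exists (lfrac v (denom1 p)); apply/eqP => /lfrac_eq0.
Qed.

Definition quotm_pi V (N : submodClosed V) (v : V) : quotm N := \pi_(quotm N) v.

Lemma quotm_piE V (N : submodClosed V) (x : quotm N) : exists v, x = quotm_pi N v.
Proof. by exists (repr x); rewrite /quotm_pi reprK. Qed.

Lemma quotm_piD V (N : submodClosed V) (u v : V) :
  quotm_pi N (u + v) = quotm_pi N u + quotm_pi N v.
Proof. exact: quotm_addE. Qed.

Lemma quotm_piZ V (N : submodClosed V) a (v : V) :
  quotm_pi N (a *: v) = a *: quotm_pi N v.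
Proof. by rewrite -[RHS]/(quotm_scale a _) quotm_scaleE. Qed.

Lemma quotm_pi_eq V (N : submodClosed V) (u v : V) :
  quotm_pi N u = quotm_pi N v <-> u - v \in N.
Proof. by split=> [/eqP|Nuv]; [|apply/eqP]; rewrite -Quotient.idealrBE. Qed.

Lemma quotm_pi_eq0 V (N : submodClosed V) (v : V) :
  quotm_pi N v = 0 <-> v \in N.
Proof.
by rewrite -(scale0r (quotm_pi N 0)) -quotm_piZ scaler0 quotm_pi_eq subr0.
Qed.

Lemma sat_quotm V (N : submodClosed V) p (v : V) :
  sat p [set 0] (quotm_pi N v) <-> sat p [set` N] v.
Proof.
by split=> -[s sp h]; exists s => //; move: h; rewrite /= -quotm_piZ quotm_pi_eq0.
Qed.

Lemma supp_quotm V (N : submodClosed V) p :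
  supp (quotm N) p <-> suppN [set` N] p.
Proof.
rewrite supp_suppN; split=> [[x]|[v nv]].
  by have [v ->] := quotm_piE x; rewrite sat_quotm => nv; exists v.
by exists (quotm_pi N v); rewrite sat_quotm.
Qed.

Lemma supp_subm V (N : submodClosed V) p :
  supp (subm N) p <-> exists2 v : V, v \in N & ~ sat p [set 0] v.
Proof.
rewrite supp_suppN; split=> [[x nx]|[v Nv nv]].
  exists (val x); first exact: valP x.
  move=> [s sp sx]; apply: nx; exists s => //.
  exact: val_inj.
exists (Sub v Nv) => -[s sp /(congr1 val) sx]; apply: nv; exists s => //.
Qed.

Lemma suppN_ideal (J : set R^o) p : submodule J -> suppN J p <-> J `<=` [set a | (a : R) \in p].
Proof.
move=> sJ; split=> [[v nv] a Ja|Jp].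
  apply: contrapT => /negP ap; apply: nv; exists a => //.
  by rewrite -[_ *: _]/(a * v) mulrC; apply: (subZ sJ).
exists 1 => -[s sp]; rewrite -[_ *: _]/(s * 1) mulr1 => /Jp.
exact/negP.
Qed.

End Supports.

(** * Suprema of sets of lengths *)

Section Dimension.

Lemma ereal_supremumE (S : set (\bar int)) (x0 y : \bar int) : S !=set0 ->
  supremums S y -> supremum x0 S = y.
Proof.
move=> /set0P/negbTE S0 Sy; rewrite /supremum S0.
by apply: is_subset1_supremums (Sy); apply: xgetPex; exists y.
Qed.

(** The common shape of [mdim], for lengths of chains, and of [depth], for lengths of regular
    sequences. *)
Definition nat_sup (S : set nat) : \bar int :=
  supremum -oo%E [set (n%:Z)%:E | n in S]%E.

Lemma nat_sup_max (S : set nat) n : S n -> (forall k, S k -> (k <= n)%N) ->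
  nat_sup S = (n%:Z)%:E.
Proof.
move=> Sn Sle; apply: ereal_supremumE; first by exists (n%:Z)%:E, n.
split=> [_ [k Sk <-]|y]; first by rewrite lee_fin lez_nat Sle.
by apply; exists n.
Qed.

Lemma nat_max (S : set nat) n0 d : S n0 -> (forall k, S k -> (k <= d)%N) ->
  exists2 n, S n & forall k, S k -> (k <= n)%N.
Proof.
move=> Sn0 Sd; have ex : exists n, `[< S n >] by exists n0; apply/asboolP.
have ub k : `[< S k >] -> (k <= d)%N by move=> /asboolP/Sd.
by case: (ex_maxnP ex ub) => n /asboolP Sn h; exists n => // k /asboolP/h.
Qed.

Lemma nat_sup_unbounded (S : set nat) n0 : S n0 ->
  ~ (exists d, forall k, S k -> (k <= d)%N) -> nat_sup S = +oo%E.
Proof.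
move=> Sn0 nbd; apply: ereal_supremumE; first by exists (n0%:Z)%:E, n0.
split=> [_ [k Sk <-]|y ubS]; first by rewrite leey.
case: y ubS => [r|//|] ubS; last first.
  by have : ((n0%:Z)%:E <= -oo :> \bar int)%E by apply: ubS; exists n0.
case: nbd; exists `|r|%N => k Sk.
have : ((k%:Z)%:E <= r%:E)%E by apply: ubS; exists k.
by rewrite lee_fin; lia.
Qed.

Lemma nat_sup0 : nat_sup set0 = -oo%E.
Proof. by rewrite /nat_sup image_set0 supremum0. Qed.

(** The empty set gives [-oo] and an unbounded one [+oo], so a finite supremum is a maximum. *)
Lemma nat_sup_eq (S : set nat) (n : nat) : nat_sup S = (n%:Z)%:E ->
  S n /\ forall k, S k -> (k <= n)%N.
Proof.
move=> Sn; have [S0|/set0P[n0 Sn0]] := eqVneq S set0.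
  by move: Sn; rewrite S0 nat_sup0.
have [[d Sd]|nbd] := pselect (exists d, forall k, S k -> (k <= d)%N).
  have [m Sm mmax] := nat_max Sn0 Sd.
  by move: Sn; rewrite (nat_sup_max Sm mmax) => -[<-].
by move: Sn; rewrite (nat_sup_unbounded Sn0 nbd).
Qed.

Lemma nat_sup_le (S : set nat) (z : int) :
  (nat_sup S <= z%:E)%E <-> forall k, S k -> k%:Z <= z.
Proof.
have [->|/set0P[n0 Sn0]] := eqVneq S set0; first by rewrite nat_sup0 leNye.
split=> [|Sz].
  have [[d Sd]|nbd] := pselect (exists d, forall k, S k -> (k <= d)%N).
    have [m Sm mmax] := nat_max Sn0 Sd.
    rewrite (nat_sup_max Sm mmax) lee_fin => mz k Sk; apply: le_trans mz.
    by rewrite lez_nat mmax.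
  by rewrite (nat_sup_unbounded Sn0 nbd).
have [|m Sm mmax] := nat_max (d := `|z|%N) Sn0; first by move=> k /Sz; lia.
by rewrite (nat_sup_max Sm mmax) lee_fin; apply: Sz.
Qed.

End Dimension.

(** * The dimension filtration indexed by all natural numbers *)

Section Filtration.
Variables (R : comNzRingType) (V : lmodType R).
Implicit Types (p P Q : prime_idealr R) (N K : submodClosed V).

(* [p] is in the support of [R v]. *)
Definition ann_le (v : V) p := forall a, a *: v = 0 -> a \in p.

Lemma ann_le_sat v p : ann_le v p <-> ~ sat p [set 0] v.
Proof.
split=> [vp [s sp /= /vp]|nv a av]; first exact/negP.
by apply: contrapT => /negP ap; apply: nv; exists a.
Qed.

Lemma ann_le_up v p (q : prime_idealr R) : ann_le v p -> {subset p <= q} -> ann_le v q.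
Proof. by move=> vp pq a /vp/pq. Qed.

Lemma ann_leZ a v p : ann_le (a *: v) p -> ann_le v p.
Proof. by move=> vp b bv; apply: vp; rewrite scaleCA bv scaler0. Qed.

Lemma ann_le_mulP a v p : ann_le v p -> a \notin p -> ann_le (a *: v) p.
Proof.
move=> vp ap b; rewrite scalerA => /vp; rewrite prime_idealrM.
by rewrite (negbTE ap) orbF.
Qed.

Lemma ann_leD u v p : ann_le (u + v) p -> ann_le u p \/ ann_le v p.
Proof.
move=> uvp; have [|nu] := pselect (ann_le u p); [by left|right].
have [a /not_implyP[au ap]] := (existsNP _).2 nu.
move=> b bv; have /uvp : (a * b) *: (u + v) = 0.
  by rewrite scalerDr mulrC -scalerA au scaler0 mulrC -scalerA bv scaler0 addr0.
by rewrite prime_idealrM (negbTE (introN idP ap)).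
Qed.

(* The submodule M_(n-1) of the paper: the shift gives [dimfilt 0] = 0. *)
Definition dimfilt_pred (n : nat) : {pred V} :=
  fun v => `[< forall k, chain_lengths (ann_le v) k -> (k < n)%N >].

Lemma dimfilt_closed n : subsemimod_closed (dimfilt_pred n).
Proof.
split=> [|a v /asboolP Fv]; last first.
  apply/asboolP => k h; apply: Fv; apply: chain_lengths_sub h => p; exact: ann_leZ.
split=> [|u v /asboolP Fu /asboolP Fv]; apply/asboolP => k [p [p0 ps]].
  by have := p0 0%N isT 1 (scaler0 _ _); rewrite idealr1.
(* The least prime of the chain decides: it contains the annihilator of [u] or that of [v], and so
   do all the primes above it. *)
have sub i : (i <= k)%N -> {subset p 0%N <= p i} by move=> ik; apply: chain_sub ps _ _ _ _.
case: (ann_leD (p0 0%N isT)) => h; [apply: Fu|apply: Fv]; exists p;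
  by split=> // i ik; apply: ann_le_up h _; apply: sub.
Qed.

HB.instance Definition _ n :=
  GRing.isSubmodClosed.Build R V (dimfilt_pred n) (dimfilt_closed n).

Definition dimfilt n : submodClosed V := dimfilt_pred n.

Lemma dimfiltP n v :
  (v \in dimfilt n) <-> forall k, chain_lengths (ann_le v) k -> (k < n)%N.
Proof. by apply: iff_sym; exact: (rwP (asboolP _)). Qed.

Lemma supp_ann_le N p : supp (subm N) p <-> exists2 v, v \in N & ann_le v p.
Proof. by rewrite supp_subm; split=> -[v Nv /ann_le_sat]; exists v. Qed.

(** The least prime of the chain lies over the annihilator of one element, hence so does the whole
    chain: dimension is tested on cyclic submodules. *)
Lemma chain_supp_ann_le N k : chain_lengths (supp (subm N)) k ->
  exists2 v, v \in N & chain_lengths (ann_le v) k.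
Proof.
move=> [p [p0 ps]]; have /supp_ann_le[v Nv vp] := p0 0%N isT.
exists v => //; exists p; split=> // i ik; apply: ann_le_up vp _.
exact: chain_sub ps _ _ _ _.
Qed.

Lemma sub_dimfilt n N :
  {subset N <= dimfilt n} <-> forall k, chain_lengths (supp (subm N)) k -> (k < n)%N.
Proof.
split=> [Nn k /chain_supp_ann_le[v /Nn/dimfiltP]|h v Nv]; first exact.
apply/dimfiltP => k vk; apply: h; apply: chain_lengths_sub vk => p vp.
by apply/supp_ann_le; exists v.
Qed.

Lemma dimfilt_mono m n : (m <= n)%N -> {subset dimfilt m <= dimfilt n}.
Proof. by move=> mn v /dimfiltP h; apply/dimfiltP => k /h km; apply: leq_trans mn. Qed.

Lemma largest_dimfilt n N :
  largest_dim_le n%:Z N <-> N = dimfilt n.+1.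
Proof.
have le K : (mdim (subm K) <= (n%:Z)%:E)%E <-> {subset K <= dimfilt n.+1}.
  rewrite sub_dimfilt -/(nat_sup _) nat_sup_le.
  by split=> h k /h; rewrite lez_nat ltnS.
split=> [[/le Nle h]|->].
  by apply: submod_ext => v; apply/idP/idP => [/Nle //|]; apply: h; apply/le.
by split=> [|K /le //]; apply/le.
Qed.

Hypothesis Rn : noetherian_module R^o.

Lemma dimfilt0 v : (v \in dimfilt 0) = (v == 0).
Proof.
apply/idP/eqP => [/dimfiltP h|->]; last exact: (@rpred0 _ (dimfilt 0)).
apply: contrapT => v0.
have [P vP] := exists_prime_over Rn (@submodule0 _ V) v0.
by have := h 0%N (chain_lengths0 vP).
Qed.

Variable d : nat.
Hypothesis dim_le : forall k, chain_lengths (supp V) k -> (k <= d)%N.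

Lemma ann_le_supp v p : ann_le v p -> supp V p.
Proof. by move=> /ann_le_sat nv; apply/supp_suppN; exists v. Qed.

Lemma dimfilt_top v : v \in dimfilt d.+1.
Proof.
apply/dimfiltP => k vk; rewrite ltnS; apply: dim_le.
by apply: chain_lengths_sub vk => p; apply: ann_le_supp.
Qed.

Lemma dim_subm N v : v \in N -> v != 0 -> exists n : nat,
  [/\ (n <= d)%N, mdim (subm N) = (n%:Z)%:E & forall m, {subset N <= dimfilt m} <-> (n < m)%N].
Proof.
move=> Nv /eqP v0.
have [P vP] := exists_prime_over Rn (@submodule0 _ V) v0.
have S0 : chain_lengths (supp (subm N)) 0.
  by apply: (@chain_lengths0 _ _ P); apply/supp_ann_le; exists v.
have Sd k : chain_lengths (supp (subm N)) k -> (k <= d)%N.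
  move=> h; apply: dim_le; apply: chain_lengths_sub h => p /supp_ann_le[w _].
  exact: ann_le_supp.
have [n Sn nmax] := nat_max S0 Sd; exists n; split; first exact: Sd.
  exact: nat_sup_max.
move=> m; rewrite sub_dimfilt; split=> [|nm k /nmax kn]; first exact.
exact: leq_ltn_trans nm.
Qed.

Definition filt_dim (n : nat) := submodule_dims V (n%:Z)%:E.

(** If the two terms differ, the larger one is itself a submodule of dimension exactly [n]. *)
Lemma dimfiltS_eq n : ~ filt_dim n -> dimfilt n.+1 = dimfilt n.
Proof.
move=> nS; apply: submod_ext => v; apply/idP/idP => [Fv|]; last exact: dimfilt_mono.
apply: contrapT => nFv; apply: nS; exists (dimfilt n.+1).
have v0 : v != 0 by apply/eqP => v0; apply: nFv; rewrite v0; exact: (@rpred0 _ (dimfilt n)).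
split; first by exists v.
have [m [_ -> mP]] := dim_subm Fv v0; congr (_%:Z%:E).
apply/eqP; rewrite eqn_leq -ltnS; apply/andP; split; first exact/mP.
by rewrite leqNgt; apply/negP => /mP/(_ v Fv).
Qed.

Lemma dimfilt_eq m n : (m <= n)%N -> (forall k, (m <= k < n)%N -> ~ filt_dim k) ->
  dimfilt m = dimfilt n.
Proof.
elim: n => [|n IH]; first by rewrite leqn0 => /eqP->.
rewrite leq_eqVlt => /orP[/eqP-> //|mn] h.
rewrite IH //; first by rewrite -dimfiltS_eq //; apply: h; rewrite ltnSn andbT.
by move=> k /andP[mk kn]; apply: h; rewrite mk ltnW.
Qed.

(** The filtration is constant between consecutive dimensions, so the term just after one dimension
    is the term at the next. The [if] starts the filtration at $F_0 = 0$. *)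
Lemma dimfilt_nth (ns : seq nat) i : sorted ltn ns ->
  (forall n, filt_dim n <-> n \in ns) -> (i < size ns)%N ->
  dimfilt (if i is j.+1 then (nth 0%N ns j).+1 else 0%N) = dimfilt (nth 0%N ns i).
Proof.
move=> sns nsP ilt.
have mono := @sorted_ltn_nth _ _ ltn_trans 0%N ns sns.
apply: dimfilt_eq; first by case: i ilt => // j jlt; apply: mono; rewrite ?inE // ltnW.
move=> k kin /nsP kns; have klt : (index k ns < size ns)%N by rewrite index_mem.
have kE : nth 0%N ns (index k ns) = k by rewrite nth_index.
have ki : (index k ns < i)%N.
  rewrite ltnNge leq_eqVlt; apply/negP => /orP[/eqP iE|ik].
    by move: kin; rewrite iE kE ltnn andbF.
  have := mono i (index k ns) ilt klt ik; rewrite kE.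
  by move: kin => /andP[_]; lia.
case: i ilt ki kin => // j jlt; rewrite ltnS leq_eqVlt => /orP[/eqP jE|kj].
  by rewrite -jE kE ltnn.
have := mono _ _ klt (ltnW jlt : (j \in [pred n | n < size ns])%N) kj.
by rewrite kE => + /andP[]; lia.
Qed.

Lemma supp_subquot0 N p : ~ supp (subquot N N) p.
Proof.
move/supp_quotm=> [x nx]; apply: nx; exists 1; rewrite ?idealr1 //= scale1r.
exact: valP x.
Qed.

Lemma filt_dimP (x : \bar int) : submodule_dims V x ->
  exists n : nat, (n <= d)%N /\ x = (n%:Z)%:E.
Proof. by move=> [N [[v Nv v0] <-]]; have [n [nd -> _]] := dim_subm Nv v0; exists n. Qed.

(** Since $D_i = F_{d_i + 1}$ and $D_{i-1} = F_{d_i}$, the quotients of the dimension filtration are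
    the layers at the $d_i$. All other layers are zero, hence have empty support and satisfy the
    condition vacuously. *)
Lemma sequentially_cohen_macaulayP : sequentially_cohen_macaulay V <->
  forall n, cohen_macaulay (subquot (dimfilt n.+1) (dimfilt n)).
Proof.
split=> [[ds [D [[sds dsP D0 DP] Dcm]]] n|cm].
  have [ns dsE] : exists ns, ds = map Posz ns.
    exists (map absz ds); rewrite -map_comp map_id_in // => z zds.
    have [|m [_ [->]]//] := @filt_dimP z%:E.
    by rewrite dsP /=; apply: map_f.
  have sns : sorted ltn ns by move: sds; rewrite dsE sorted_map.
  have nsP m : filt_dim m <-> m \in ns.
    rewrite /filt_dim dsP dsE -map_comp /=; split=> [/mapP[k kns [->]]//|].
    exact: (map_f (fun m : nat => (m%:Z)%:E)).
  have [nS|nS] := pselect (filt_dim n); last first.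
    by rewrite (dimfiltS_eq nS) => P _ /supp_subquot0.
  have nns : n \in ns by apply/nsP.
  pose i := index n ns; have ilt : (i < size ns)%N by rewrite index_mem.
  have nE : nth 0%N ns i = n by rewrite nth_index.
  have DE j : (j < size ns)%N -> D j.+1 = dimfilt (nth 0%N ns j).+1.
    move=> jlt; apply/largest_dimfilt; have := DP j.
    by rewrite dsE size_map => /(_ jlt); rewrite (nth_map 0%N).
  have := Dcm i; rewrite dsE size_map => /(_ ilt); rewrite (DE _ ilt) nE.
  suff -> : D i = dimfilt n by [].
  rewrite -nE -dimfilt_nth //; case: (i) ilt => [|j] jlt; last by rewrite DE // ltnW.
  by apply: submod_ext => v; rewrite D0 dimfilt0.
pose ns := [seq n <- iota 0 d.+1 | `[< filt_dim n >]].
have nsP m : filt_dim m <-> m \in ns.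
  rewrite mem_filter mem_iota /= add0n; split=> [mS|/andP[/asboolP]//].
  rewrite (asboolT mS); have [k [kd]] := filt_dimP mS.
  by move=> -[->].
have sns : sorted ltn ns by apply: sorted_filter (iota_ltn_sorted _ _); exact: ltn_trans.
exists (map Posz ns), (fun i => dimfilt (if i is j.+1 then (nth 0%N ns j).+1 else 0%N)).
split; last first.
  by move=> i; rewrite size_map => ilt; rewrite dimfilt_nth.
split=> [|||i].
- by rewrite sorted_map.
- apply/seteqP; split=> x; rewrite /= -map_comp.
    move=> xS; have [n [_ xE]] := filt_dimP xS; rewrite xE in xS *.
    by apply: (map_f (fun m : nat => (m%:Z)%:E)); apply/nsP.
  by move=> /mapP[n /nsP nS ->].
- by move=> v; rewrite dimfilt0.
- rewrite size_map => ilt; rewrite (nth_map 0%N) //.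
  exact/largest_dimfilt.
Qed.

End Filtration.

(** * Localization *)

Section LocalRing.
Variables (R : comNzRingType) (P : prime_idealr R).
Implicit Types (V W : lmodType R).

Definition locr_of (a : R) : locr P := lfracr a (denom1 P).

Definition locm_of V (v : V) : locm P V := lfrac v (denom1 P).

Lemma locr_ofD a b : locr_of (a + b) = locr_of a + locr_of b.
Proof. by rewrite [RHS]lfracrD; apply/lfracrP; exists (denom1 P) => /=; ring. Qed.

Lemma locr_ofM a b : locr_of (a * b) = locr_of a * locr_of b.
Proof. by rewrite [RHS]locr_mulE; apply/lfracrP; exists (denom1 P) => /=; ring. Qed.

Lemma locr_of1 : locr_of 1 = 1.
Proof. by []. Qed.

Lemma locr_of0 : locr_of 0 = 0.
Proof. by []. Qed.

Lemma locm_ofD V (u v : V) : locm_of (u + v) = locm_of u + locm_of v.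
Proof.
rewrite [RHS]lfracD; apply/lfracP; exists (denom1 P) => /=.
by rewrite !mul1r !scale1r.
Qed.

Lemma scale_lfrac V a s (v : V) t :
  (lfracr a s : locr P) *: lfrac v t = lfrac (a *: v) (denomM s t).
Proof. by rewrite -[LHS]/(locm_scale _ _) locm_scaleE. Qed.

Lemma locm_ofZ V a (v : V) : locm_of (a *: v) = locr_of a *: locm_of v.
Proof.
rewrite scale_lfrac; apply/lfracP; exists (denom1 P) => /=.
by rewrite !mul1r !scale1r.
Qed.

Lemma scale_denom V (v : V) (s : denom P) :
  locr_of (dval s) *: lfrac v s = locm_of v.
Proof.
rewrite scale_lfrac; apply/lfracP; exists (denom1 P) => /=.
by rewrite !mul1r !scale1r.
Qed.

Lemma locm_of_surj V (x : locm P V) :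
  exists s v, s \notin P /\ locr_of s *: x = locm_of v.
Proof.
have [v [s ->]] := lfracE x; exists (dval s), v; split; first exact: valP s.
exact: scale_denom.
Qed.

Lemma locr_of_surj (x : locr P) :
  exists s a, s \notin P /\ locr_of s * x = locr_of a.
Proof. exact: (@locm_of_surj R^o x). Qed.

Lemma locr_inv a : a \notin P -> exists b : locr P, b * locr_of a = 1.
Proof.
move=> aP; exists (lfracr 1 (Denom aP)); rewrite [LHS]locr_mulE.
by apply/lfracrP; exists (denom1 P) => /=; ring.
Qed.

Lemma locm_of_eq0 V (v : V) : locm_of v = 0 <-> sat P [set 0] v.
Proof. exact: lfrac_eq0. Qed.

Lemma contract_subproof (q : prime_idealr (locr P)) :
  exists p : prime_idealr R, forall a, (a \in p) <-> (locr_of a \in q).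
Proof.
apply: set_prime_idealr; split=> [||a b] /=; last first.
- by rewrite locr_ofM prime_idealrM => /orP.
- by rewrite locr_of1 idealr1.
split=> [|a b|a b]; first by rewrite /= locr_of0 idealr0.
- by rewrite /= locr_ofD; apply: rpredD.
- by rewrite /= locr_ofM; apply: idealMr.
Qed.

Definition contraction q := sval (cid (contract_subproof q)).

Lemma contractP q a : (a \in contraction q) = (locr_of a \in q).
Proof. by rewrite /contraction; case: cid => p pP /=; apply/idP/idP => /pP. Qed.

Lemma locr_of_prime (q : prime_idealr (locr P)) s : s \notin P -> locr_of s \notin q.
Proof.
move=> /locr_inv[b bs]; apply/negP => sq.
by have := @idealMr _ q b _ sq; rewrite bs idealr1.
Qed.

Lemma contract_sub q : {subset contraction q <= P}.
Proof. by move=> a; rewrite contractP; apply: contraLR => /locr_of_prime. Qed.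

Lemma in_contract (q : prime_idealr (locr P)) x s a : s \notin P ->
  locr_of s * x = locr_of a -> (x \in q) = (a \in contraction q).
Proof.
move=> sP E; rewrite contractP -E prime_idealrM.
by rewrite (negbTE (locr_of_prime q sP)).
Qed.

Lemma extend_prime (p : prime_idealr R) : {subset p <= P} ->
  exists q, contraction q =i p.
Proof.
move=> pP; pose S : set (locr P)^o :=
  [set x : locr P | exists s a, [/\ s \notin P, a \in p & locr_of s * x = locr_of a]].
(* [S] is $pR_P$, and this says that it contracts to [p]: the denominators are outside [P], hence
   outside [p]. *)
have SE a : S (locr_of a) <-> a \in p.
  split=> [[s [b [sP bp]]]|ap]; last first.
    by exists 1, a; rewrite idealr1 locr_of1 mul1r.
  rewrite -locr_ofM => /lfracrP[u]; rewrite /= !mul1r => E.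
  have : dval u * (s * a) \in p by rewrite E idealMr.
  rewrite !prime_idealrM => /orP[/pP|/orP[/pP|//]].
    by have /negP := valP u.
  by move/negP: sP.
have [|q qS] := @set_prime_idealr _ S; last first.
  by exists q => a; rewrite contractP; apply/idP/idP => [/qS/SE//|ap]; apply/qS/SE.
split.
- split=> [|x y [s [a [sP ap E]]] [t [b [tP bp E']]]|c x [s [a [sP ap E]]]].
  + by rewrite -locr_of0; apply/SE; rewrite idealr0.
  + exists (s * t), (t * a + s * b); split; first exact: notin_primeM.
      by rewrite rpredD // idealMr.
    rewrite locr_ofD !locr_ofM -E -E'.
    by rewrite mulrDr; congr (_ + _); ring.
  + have [r [b [rP E']]] := locr_of_surj c.
    exists (r * s), (b * a); split; [exact: notin_primeM|exact: idealMr|].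
    rewrite !locr_ofM -E -E' -[c *: x]/(c * x); ring.
- by rewrite -locr_of1 => /SE; rewrite idealr1.
- move=> x y [s [a [sP ap E]]].
  have [r [b [rP Eb]]] := locr_of_surj x; have [t [c [tP Ec]]] := locr_of_surj y.
  have : locr_of (s * (b * c)) = locr_of (r * t * a).
    rewrite !locr_ofM -E -Eb -Ec; ring.
  move=> h; have : S (locr_of (s * (b * c))) by rewrite h; apply/SE; rewrite idealMr.
  move=> /SE; rewrite !prime_idealrM => /orP[/pP|/orP[bp|cp]].
  + by move/negP: sP.
  + by left; exists r, b.
  + by right; exists t, c.
Qed.

(** Contraction is an order isomorphism from the primes of $R_P$ to the primes inside [P]; here it
    is transported to chains. *)
Lemma chain_lengths_contract (X : prime_idealr R -> Prop) n :
  (forall p q : prime_idealr R, X p -> {subset p <= q} -> X q) ->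
  chain_lengths (fun q => X (contraction q)) n <->
  chain_lengths (fun p => X p /\ {subset p <= P}) n.
Proof.
move=> Xup; split=> [[q [Xq qs]]|[p [Xp ps]]].
  exists (contraction \o q); split=> [i ik|i ik] /=.
    by split; [exact: Xq|exact: contract_sub].
  have [sub nsub] := qs i ik; split=> [a /=|sub'].
    by rewrite !contractP; apply: sub.
  apply: nsub => x /=; have [s [a [sP E]]] := locr_of_surj x.
  by rewrite !(in_contract _ sP E) => /sub'.
have ex i : exists q, (i <= n)%N -> contraction q =i p i.
  have [ik|nik] := boolP (i <= n)%N; last first.
    (* Beyond the chain any prime serves; an extension of [P] fills these places. *)
    have [q _] := extend_prime (fun a (aP : a \in P) => aP).
    by exists q.
  by have [q qE] := extend_prime (Xp i ik).2; exists q.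
have [q qE] := choice ex; exists q; split=> i ik.
  by apply: Xup (Xp i ik).1 _ => a; rewrite (qE i).
have [sub nsub] := ps i ik; split=> [x|sub'] /=.
  have [s [a [sP E]]] := locr_of_surj x.
  by rewrite !(in_contract _ sP E) !qE ?(ltnW ik) //; apply: sub.
by apply: nsub => a /=; rewrite -(qE i.+1) // -(qE i (ltnW ik)) !contractP; apply: sub'.
Qed.

Lemma locr_max_subproof : exists q, contraction q =i P.
Proof. exact: extend_prime. Qed.

Definition locr_max := sval (cid locr_max_subproof).

Lemma locr_maxP : contraction locr_max =i P.
Proof. exact: svalP (cid locr_max_subproof). Qed.

Lemma locr_of_max a : (locr_of a \in locr_max) = (a \in P).
Proof. by rewrite -contractP locr_maxP. Qed.

Lemma locr_max_unit x : x \notin locr_max -> exists y, y * x = 1.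
Proof.
have [s [a [sP E]]] := locr_of_surj x; rewrite (in_contract _ sP E) locr_maxP.
move=> /locr_inv[b ba]; exists (b * locr_of s).
by rewrite -mulrA E.
Qed.

End LocalRing.

(** * Depth and regular sequences over a local ring *)

Section LocalUnits.
Variables (A : comNzRingType) (m : prime_idealr A).
Hypothesis m_unit : forall x, x \notin m -> exists y, y * x = 1.

Lemma idealr_sub_max (I : idealr A) : {subset I <= m}.
Proof.
move=> x xI; apply: contraT => /m_unit[y yx].
by rewrite -(idealr1 I) -yx idealMr.
Qed.

Lemma local_maximal : maximal m.
Proof. by move=> J _; apply: idealr_sub_max. Qed.

Lemma maximal_local (I : idealr A) : maximal I -> I =i m.
Proof.
move=> maxI x; apply/idP/idP; [exact: idealr_sub_max|exact: maxI (@idealr_sub_max I) x].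
Qed.

(** Denominators outside [m] are units, so the saturated notions at [m] are the ordinary ones. *)
Lemma sat_local (V : lmodType A) (N : set V) v : submodule N -> sat m N v <-> N v.
Proof.
move=> sN; split=> [[s /m_unit[y ys] Nsv]|]; last exact: sub_sat.
by rewrite -[v]scale1r -ys -scalerA; apply: subZ.
Qed.

Hypothesis An : noetherian_module A^o.
Variable V : lmodType A.
Hypothesis Vn : noetherian_module V.
Implicit Types (N : set V) (s : seq A).

(** $N + sV$, accumulated in the order in which [grade_ge] consumes a sequence; [mul_seq] is the
    case $N = 0$. *)
Definition addmuls (N : set V) (s : seq A) : set V := foldl (fun K x => addmul x K) N s.

Lemma addmuls_submodule N s : submodule N -> submodule (addmuls N s).
Proof. by elim: s N => //= x s IH N sN; apply: IH; apply: addmul_submodule. Qed.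

Lemma sub_addmuls N s : N `<=` addmuls N s.
Proof.
elim: s N => [|x s IH] N //=.
by apply: subset_trans (IH _); apply: sub_addmul.
Qed.

Lemma mul_seq_addmuls s v : (v \in mul_seq s V) <-> addmuls [set 0] s v.
Proof.
have s0 := submodule0 V.
split=> [/asboolP|].
  have [K KE] := set_submodClosed (addmuls_submodule s s0).
  move=> /(_ K) vK; apply/KE/vK => _ [x xs [w _ <-]]; apply/KE.
  elim: s {KE vK K} xs ([set 0]) s0 => //= y s IH; rewrite inE => /orP[/eqP->|xs] N sN.
    by apply: sub_addmuls; apply: addmul_mul.
  by apply: IH => //; apply: addmul_submodule.
suff sub t N : {subset t <= s} -> N `<=` [set` mul_seq s V] ->
    addmuls N t `<=` [set` mul_seq s V].
  by apply: (sub s) => // _ ->; exact: (@rpred0 _ (mul_seq s V)).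
elim: t N => [//|x t IH] N ts Ns; apply: IH.
  by move=> y yt; apply: ts; rewrite inE yt orbT.
move=> _ [u [w [/Ns us ->]]]; apply: (subD (submodulep (mul_seq s V))) => //.
apply/asboolP => K; apply; exists x; first by apply: ts; rewrite mem_head.
by exists w.
Qed.

Lemma regular_mul_seq s x : injective (fun v : quotm (mul_seq s V) => x *: v) <->
  regular m (addmuls [set 0] s) x.
Proof.
have sN := addmuls_submodule s (submodule0 V).
split=> [inj v|reg y z].
  rewrite !sat_local // -!mul_seq_addmuls -!quotm_pi_eq0 quotm_piZ => xv.
  by apply: inj; rewrite xv scaler0.
have [v ->] := quotm_piE y; have [w ->] := quotm_piE z.
rewrite -!quotm_piZ !quotm_pi_eq -scalerBr !mul_seq_addmuls.
by rewrite -!(@sat_local _ (addmuls _ _)) //; apply: reg.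
Qed.

(** Nakayama's lemma with [K] the whole module: if $N + xV = V$, then [V] is divisible by [x] modulo
    [N]. *)
Lemma addmul_proper N x v : submodule N -> x \in m -> ~ N v ->
  exists w, ~ addmul x N w.
Proof.
move=> sN xm nv; apply: contrapT => h; apply: nv.
apply/sat_local => //; apply: (divisible_sat Vn sN xm (K := setT)) => // u _.
have [y [w [Ny E]]] : addmul x N u by apply: contrapT => nu; apply: h; exists u.
by exists 1, w; rewrite idealr1 scale1r {1}E addrK.
Qed.

Lemma addmuls_proper N s v : submodule N -> {subset s <= m} -> ~ N v ->
  exists w, ~ addmuls N s w.
Proof.
elim: s N v => [|x s IH] N v sN sm nv; first by exists v.
have [w nw] := addmul_proper sN (sm x (mem_head _ _)) nv.
apply: IH nw; first exact: addmul_submodule.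
by move=> y ys; apply: sm; rewrite inE ys orbT.
Qed.

Lemma grade_seq n N : grade_ge m m n N <-> exists s : seq A,
  [/\ size s = n, {subset s <= m}
    & forall i, (i < n)%N -> regular m (addmuls N (take i s)) s`_i].
Proof.
elim: n N => [|n IH] N; first by split=> // _; exists [::].
split=> [[x [xm rx /IH[s [sn sm sr]]]]|[s [sn sm sr]]].
  exists (x :: s); split=> [|y|[_|i ilt]] //=; first by rewrite sn.
    by rewrite inE => /orP[/eqP->//|/sm].
  exact: sr.
case: s sn sm sr => [//|x s] [sn] sm sr.
exists x; split; [exact/sm/mem_head|exact: (sr 0%N)|apply/IH; exists s; split=> //].
  by move=> y ys; apply: sm; rewrite inE ys orbT.
by move=> i ilt; apply: (sr i.+1).
Qed.

(** [grade_ge] does not ask for a nonzero final quotient; over a local ring [addmuls_proper]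
    supplies this clause of [regular_seq]. *)
Lemma depth_grade (I : idealr A) n : I =i m -> suppN [set (0 : V)] m ->
  [set size s | s in [set s : seq A | {subset s <= I} /\ regular_seq V s]] n <->
  grade_ge m m n [set (0 : V)].
Proof.
move=> Im [v nv]; rewrite grade_seq.
split=> [[s [sI [sr _]] <-]|[s [sn sm sr]]].
  exists s; split=> // [x /sI|i ilt]; first by rewrite Im.
  exact/regular_mul_seq/sr.
exists s => //; split; first by move=> x /sm; rewrite Im.
split=> [i|]; first by rewrite sn => ilt; apply/regular_mul_seq/sr.
have [|w nw] := @addmuls_proper [set 0] s v (submodule0 V) sm.
  by move=> v0; apply: nv; apply: sub_sat.
by exists (quotm_pi _ w); apply/eqP => /quotm_pi_eq0/mul_seq_addmuls.
Qed.

(** The bound [d] makes the dimension a finite maximum. Depth never exceeds it, so equality only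
    asks for a regular sequence of that length, which is what [cmat] records. *)
Lemma local_cohen_macaulayP d : suppN [set (0 : V)] m ->
  (forall k, chain_lengths (supp V) k -> (k <= d)%N) ->
  local_cohen_macaulay V <-> cmat m [set (0 : V)].
Proof.
move=> Vm Vd; have supE q : suppN [set (0 : V)] q /\ {subset q <= m} <-> supp V q.
  split=> [[+ _]|]; first by move/supp_suppN.
  by move/supp_suppN; split=> //; apply: idealr_sub_max.
have clE : chain_lengths (fun q => suppN [set (0 : V)] q /\ {subset q <= m}) =
    chain_lengths (supp V).
  by apply/seteqP; split; apply: chain_lengths_sub => q /supE.
have dimE : mdim V = nat_sup (chain_lengths (supp V)) by [].
have depthE (I : idealr A) : I =i m -> depth I V =
    nat_sup [set n | grade_ge m m n [set (0 : V)]].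
  move=> Im; rewrite /depth /nat_sup; congr (supremum _ _).
  apply/seteqP; split=> x /=.
    move=> [s sI <-]; exists (size s) => //; apply/(depth_grade _ Im Vm).
    by exists s.
  by move=> [n /(depth_grade _ Im Vm)[s sI <-] <-]; exists s.
rewrite /cmat clE; split=> [[I [maxI _]]|[n [Sn nmax gn]]].
  have Im := maximal_local maxI; rewrite (depthE I Im) dimE => E.
  have [n Sn nmax] : exists2 n, chain_lengths (supp V) n &
      forall k, chain_lengths (supp V) k -> (k <= n)%N.
    apply: nat_max Vd; apply: (@chain_lengths0 _ _ m).
    exact/supp_suppN.
  exists n; split=> //; move: E; rewrite (nat_sup_max Sn nmax).
  by move=> /nat_sup_eq[].
exists m; split; [exact: local_maximal|exact: maximal_local|].
rewrite (depthE m) // dimE (nat_sup_max Sn nmax).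
(* Depth is at most the dimension: [grade_chain] at an associated prime of [V] gives a chain of
   length [k] in the support. *)
apply: nat_sup_max => // k gk; apply: nmax.
have [v nv] := Vm; have s0 := submodule0 V.
have [b [p [pm pE]]] := exists_assoc An s0 nv.
have pE' a : (a \in p) <-> sat m [set 0] (a *: (b *: v)).
  by rewrite sat_local.
apply: chain_lengths_sub (grade_chain An Vn s0 gk pm pE') => q [pq _].
apply/supp_suppN; apply: suppN_up pq; exists (b *: v) => -[s sp].
by rewrite scaleCA => h; move/negP: sp; apply; apply/pE; rewrite scaleCA.
Qed.

End LocalUnits.

(** * Comparison of saturated notions with actual localizations *)

Section Transfer.
Variables (R : comNzRingType) (P : prime_idealr R).
Variables (W : lmodType R) (W' : lmodType (locr P)) (phi : W -> W').
Local Notation m := (locr_max P).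

(** The kernel is left open and is supplied for each pair [N], [N'] by [phiN]. Thus [phi] may also
    be the map from [W] to $(W/N)_P$, and quotients need no separate treatment. *)
Record localization : Prop := Localization {
  phiD : forall u v, phi (u + v) = phi u + phi v;
  phiZ : forall a v, phi (a *: v) = locr_of P a *: phi v;
  phi_surj : forall w', exists s w, s \notin P /\ locr_of P s *: w' = phi w }.

Hypothesis phiP : localization.

(** Pulling back along [phi] reflects inclusions, because up to a unit every element of [W'] is in
    the image; the maximal condition is therefore inherited. *)
Lemma noetherian_localization : noetherian_module W -> noetherian_module W'.
Proof.
move=> Wn F Fsub [N' FN'].
pose pull (K : set W') : set W := [set v | K (phi v)].
have sub (K L : set W') : submodule K -> submodule L -> pull K `<=` pull L -> K `<=` L.
  move=> sK sL KL w' Kw'; have [s [w [sP E]]] := phi_surj phiP w'.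
  have /KL : pull K w by rewrite /pull /= -E; apply: subZ.
  rewrite /pull /= -E => h; have [b bs] := locr_inv sP.
  by rewrite -[w']scale1r -bs -scalerA; apply: subZ.
have [||_ [K FK <-] Kmax] := Wn [set pull K | K in F].
- move=> _ [K /Fsub sK <-]; split=> [|u v|a v]; rewrite /pull /=.
  + have := phiZ phiP 0 0; rewrite scale0r => ->.
    by rewrite locr_of0 scale0r; apply: sub0.
  + by rewrite (phiD phiP); apply: subD.
  + by rewrite (phiZ phiP); apply: subZ.
- by exists (pull N'), N'.
exists K => // L FL KL; apply: sub; [exact: Fsub|exact: Fsub|].
by apply: Kmax => [|v]; [exists L | apply: KL].
Qed.

Variables (N : set W) (N' : set W').
Hypotheses (sN : submodule N) (sN' : submodule N').
Hypothesis phiN : forall v, N' (phi v) <-> sat P N v.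

Lemma phi_unit (K : set W') s w' : submodule K -> s \notin P ->
  K (locr_of P s *: w') -> K w'.
Proof.
move=> sK sP h; have [b bs] := locr_inv sP.
by rewrite -[w']scale1r -bs -scalerA; apply: subZ.
Qed.

Lemma suppN_contract q : suppN N' q <-> suppN N (contraction q).
Proof.
split=> [[w' nw']|[w nw]].
  have [s [w [sP E]]] := phi_surj phiP w'; exists w => -[t tq Nw]; apply: nw'.
  exists (locr_of P (t * s)).
    rewrite -contractP prime_idealrM negb_or tq.
    by apply: contraNN sP; apply: contract_sub.
  rewrite locr_ofM -scalerA E -(phiZ phiP); apply/phiN; exact: sub_sat.
exists (phi w) => -[x xq Nx]; apply: nw.
have [s [a [sP E]]] := locr_of_surj x.
have : N' (phi (a *: w)) by rewrite (phiZ phiP) -E -scalerA; apply: subZ.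
move=> /phiN[t tP Nt]; exists (t * a); last by rewrite -scalerA.
rewrite prime_idealrM negb_or -(in_contract _ sP E) xq andbT.
by apply: contraNN tP; apply: contract_sub.
Qed.

(** The relation [phiN] survives division by [x], which carries the induction on the length of a
    regular sequence. *)
Lemma phi_addmul x v : addmul (locr_of P x) N' (phi v) <-> sat P (addmul x N) v.
Proof.
have sA := addmul_submodule (locr_of P x) sN'.
split=> [[n' [w' [Nn' E]]]|[s sP [n [w [Nn E]]]]].
  have [s [w [sP Ew]]] := phi_surj phiP w'.
  have /phiN[t tP Nt] : N' (phi (s *: v - x *: w)).
    have -> : phi (s *: v - x *: w) = phi (s *: v) - phi (x *: w).
      by apply/eqP; rewrite eq_sym subr_eq -(phiD phiP) subrK.
    rewrite !(phiZ phiP) E -Ew scalerDr [locr_of P s *: (_ *: w')]scaleCA addrK.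
    exact: subZ.
  exists (t * s); first exact: notin_primeM.
  exists (t *: (s *: v - x *: w)), (t *: w); split=> //.
  by rewrite scalerBr scalerA [x *: (t *: w)]scaleCA subrK.
apply: (phi_unit sA sP); rewrite -(phiZ phiP) E.
exists (phi n), (phi w); rewrite (phiD phiP) (phiZ phiP); split=> //.
by apply/phiN; apply: sub_sat.
Qed.

End Transfer.

Section TransferGrade.
Variables (R : comNzRingType) (P : prime_idealr R).
Variables (W : lmodType R) (W' : lmodType (locr P)) (phi : W -> W').
Hypothesis phiP : localization phi.
Local Notation m := (locr_max P).

Lemma regular_localization (N : set W) (N' : set W') x :
  submodule N -> submodule N' -> (forall v, N' (phi v) <-> sat P N v) ->
  regular m N' (locr_of P x) <-> regular P N x.
Proof.
move=> sN sN' phiN; have unit := @locr_max_unit _ P.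
split=> reg v.
  move=> /phiN; rewrite (phiZ phiP) => /(@sub_sat _ _ m)/reg.
  by move=> /(sat_local unit _ sN')/phiN.
move=> /(sat_local unit _ sN') Nv; apply: sub_sat.
have [s [w [sP E]]] := phi_surj phiP v.
apply: (phi_unit sN' sP); rewrite E; apply/phiN/reg/phiN.
by rewrite (phiZ phiP) -E scaleCA; apply: subZ.
Qed.

Lemma grade_localization (N : set W) (N' : set W') n :
  submodule N -> submodule N' -> (forall v, N' (phi v) <-> sat P N v) ->
  grade_ge m m n N' <-> grade_ge P P n N.
Proof.
elim: n N N' => [//|n IH] N N' sN sN' phiN /=.
have IHx x : grade_ge m m n (addmul (locr_of P x) N') <-> grade_ge P P n (addmul x N).
  apply: IH; [exact: addmul_submodule|exact: addmul_submodule|].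
  by move=> v; apply: phi_addmul.
split=> [[x' [xm rx gx]]|[x [xP rx gx]]]; last first.
  exists (locr_of P x); rewrite locr_of_max; split=> //.
    exact/(regular_localization _ sN).
  exact/IHx.
have [s [x [sP E]]] := locr_of_surj x'.
exists x; split.
- by rewrite -locr_of_max -E idealMr.
- apply/(regular_localization _ sN sN' phiN) => v; rewrite -E -scalerA.
  by move=> /(satZ (locr_of_prime m sP))/rx.
(* [x'] and the image of [x] differ by the unit [locr_of P s], so both give the same submodule. *)
apply/IHx; suff -> : addmul (locr_of P x) N' = addmul x' N' by [].
have [b bs] := locr_inv sP.
have x'E : x' = b * locr_of P x by rewrite -E mulrA bs mul1r.
apply/seteqP; split=> _ [u [w [Nu ->]]]; exists u.
  by exists (locr_of P s *: w); rewrite scaleCA scalerA E.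
by exists (b *: w); rewrite scaleCA scalerA -x'E.
Qed.

Lemma cmat_localization (N : set W) (N' : set W') :
  submodule N -> submodule N' -> (forall v, N' (phi v) <-> sat P N v) ->
  cmat m N' <-> cmat P N.
Proof.
move=> sN sN' phiN; have supE := suppN_contract phiP sN' phiN.
have clE : chain_lengths (fun q => suppN N' q /\ {subset q <= m}) =
    chain_lengths (fun p => suppN N p /\ {subset p <= P}).
  apply/seteqP; split=> n.
    move=> h; apply/chain_lengths_contract; first exact: suppN_up.
    by apply: chain_lengths_sub h => q [/supE].
  move=> h0; have [_ /(_ h0) h] := @chain_lengths_contract _ P _ n (@suppN_up _ _ N).
  apply: chain_lengths_sub h => q /supE; split=> //.
  exact: (idealr_sub_max (@locr_max_unit _ P)).
by rewrite /cmat clE; split=> -[n [Sn nmax gn]]; exists n; split=> //;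
  apply/(grade_localization n sN sN' phiN).
Qed.

End TransferGrade.

Section LocalizationInstances.
Variables (R : comNzRingType) (P : prime_idealr R).
Local Notation m := (locr_max P).

Lemma locm_localization (V : lmodType R) : localization (@locm_of R P V).
Proof.
by split; [exact: locm_ofD|exact: locm_ofZ|exact: locm_of_surj].
Qed.

Lemma locr_noetherian : noetherian_module R^o -> noetherian_module (locr P)^o.
Proof.
apply: (noetherian_localization (phi := locr_of P : R^o -> (locr P)^o)).
split=> [a b|a b|x]; [exact: (locr_ofD P a b)|exact: (locr_ofM P a b)|].
exact: (locr_of_surj x).
Qed.

Lemma subm_noetherian (V : lmodType R) (N : submodClosed V) :
  noetherian_module V -> noetherian_module (subm N).
Proof.
move=> Vn F Fsub [K0 FK0]; pose push (K : set (subm N)) : set V := val @` K.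
have pushE K x : push K (val x) <-> K x.
  by split=> [[y Ky /val_inj<-]|Kx]; last exists x.
have [||_ [K FK <-] Kmax] := Vn (push @` F).
- move=> _ [K /Fsub sK <-]; split=> [|_ _ [x Kx <-] [y Ky <-]|a _ [x Kx <-]].
  + by exists 0 => //; apply: sub0.
  + by exists (x + y) => //; apply: subD.
  + by exists (a *: x) => //; apply: subZ.
- by exists (push K0), K0.
exists K => // L FL KL x Lx; apply/pushE.
apply: (Kmax (push L)); [by exists L| |exact/pushE].
by move=> _ [y Ky <-]; apply/pushE/KL.
Qed.

Lemma locm_supp_bound (V : lmodType R) d :
  (forall k, chain_lengths (supp V) k -> (k <= d)%N) ->
  forall k, chain_lengths (supp (locm P V)) k -> (k <= d)%N.
Proof.
move=> Vd k h; apply: Vd.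
have sN := submodule0 V; have sN' := submodule0 (locm P V).
have supE := suppN_contract (locm_localization V) sN' (@locm_of_eq0 _ P V).
suff : chain_lengths (fun p => suppN [set (0 : V)] p /\ {subset p <= P}) k.
  by apply: chain_lengths_sub => p [/supp_suppN].
apply/chain_lengths_contract; first exact: suppN_up.
by apply: chain_lengths_sub h => q /supp_suppN/supE.
Qed.

Hypothesis Rn : noetherian_module R^o.

Lemma local_cohen_macaulay_quotm (W : lmodType R) (N : submodClosed W) d :
  noetherian_module W -> suppN [set` N] P ->
  (forall k, chain_lengths (suppN [set` N]) k -> (k <= d)%N) ->
  local_cohen_macaulay (locm P (quotm N)) <-> cmat P [set` N].
Proof.
move=> Wn NP Nd; pose phi (w : W) := locm_of P (quotm_pi N w).
have phiP : localization phi.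
  split=> [u v|a v|w'].
  - by rewrite /phi quotm_piD locm_ofD.
  - by rewrite /phi quotm_piZ locm_ofZ.
  - have [s [y [sP E]]] := locm_of_surj w'; have [w yE] := quotm_piE y.
    by exists s, w; rewrite E yE.
have sN := submodulep N; have s0 := submodule0 (locm P (quotm N)).
have phiN v : [set 0] (phi v) <-> sat P [set` N] v.
  by rewrite /phi -sat_quotm; exact: locm_of_eq0.
rewrite -(cmat_localization phiP sN s0 phiN).
apply: (@local_cohen_macaulayP _ _ (@locr_max_unit _ P) _ _ _ d).
- exact: locr_noetherian.
- exact: noetherian_localization phiP Wn.
- apply/(suppN_contract phiP s0 phiN); apply: suppN_up NP _ => a.
  by rewrite locr_maxP.
apply: locm_supp_bound => k h; apply: Nd.
by apply: chain_lengths_sub h => p /supp_quotm.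
Qed.

Definition rel_sub (A : comNzRingType) (V : lmodType A) (N K : submodClosed V) :
  submodClosed (subm N) := @restr A V N K.

(** The hypotheses say that [N'] and [K'] are the localizations of [N] and [K]; the subquotient of
    [N'] by [K'] is then the localized subquotient. *)
Lemma cmat_subquot (V : lmodType R) (N K : submodClosed V)
    (N' K' : submodClosed (locm P V)) :
  (forall v, (locm_of P v \in N') <-> sat P [set` N] v) ->
  (forall v, (locm_of P v \in K') <-> sat P [set` K] v) ->
    (forall p, suppN [set` rel_sub N' K'] p <-> suppN [set` rel_sub N K] (contraction p)) /\
  (cmat m [set` rel_sub N' K'] <-> cmat P [set` rel_sub N K]).
Proof.
move=> NE KE.
have phi_in (x : subm N) : locm_of P (val x) \in N'.
  by apply/NE; apply: sub_sat; exact: valP x.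
pose phi (x : subm N) : subm N' := Sub (locm_of P (val x)) (phi_in x).
have phiP : localization phi.
  split=> [u v|a v|w'].
  - by apply: val_inj; exact: locm_ofD.
  - by apply: val_inj; exact: locm_ofZ.
  have [s [v [sP E]]] := locm_of_surj (val w').
  (* The numerator [v] need not lie in [N]; the extra denominator [t] moves it there. *)
  have /NE[t tP Ntv] : locm_of P v \in N'.
    by rewrite -E; apply: (@rpredZ _ _ N'); exact: valP w'.
  exists (t * s), (Sub (t *: v) Ntv); split; first exact: notin_primeM.
  apply: val_inj; change (locr_of P (t * s) *: val w' = locm_of P (t *: v)).
  by rewrite locm_ofZ -E locr_ofM scalerA.
have sN : submodule [set` rel_sub N K] by exact: submodulep.
have sN' : submodule [set` rel_sub N' K'] by exact: submodulep.
have phiN v : [set` rel_sub N' K'] (phi v) <-> sat P [set` rel_sub N K] v.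
  rewrite -[X in X <-> _]/(is_true (locm_of P (val v) \in K')) KE.
  by split=> -[s sP h]; exists s.
split; first by move=> p; exact: (suppN_contract phiP sN' phiN).
exact: (cmat_localization phiP sN sN' phiN).
Qed.

End LocalizationInstances.

(** * Layers of the dimension filtration *)

Section Layers.
Variables (R : comNzRingType) (V : lmodType R) (d : nat).
Hypotheses (Rn : noetherian_module R^o) (Vn : noetherian_module V).
Hypothesis Vd : forall k, chain_lengths (supp V) k -> (k <= d)%N.
Implicit Types (p P Q : prime_idealr R) (N K : submodClosed V).

Lemma suppN_rel_sub N K p : suppN [set` rel_sub N K] p ->
  exists2 v, v \in N & ann_le v p.
Proof.
move=> [x nx]; exists (val x); first exact: valP x.
apply/ann_le_sat => -[s sp sx]; apply: nx; exists s => //.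
by rewrite /= /rel_sub -[_ \in _]/(s *: val x \in K) sx; exact: (@rpred0 _ K).
Qed.

Lemma suppN_rel_sub_supp N K p : suppN [set` rel_sub N K] p -> supp V p.
Proof. by move=> /suppN_rel_sub[v _]; exact: ann_le_supp. Qed.

Lemma cohen_macaulay_subquot N K : cohen_macaulay (subquot N K) <->
  forall P, maximal P -> suppN [set` rel_sub N K] P -> cmat P [set` rel_sub N K].
Proof.
have Nn := subm_noetherian (N := N) Vn.
have E P (NP : suppN [set` rel_sub N K] P) :=
  @local_cohen_macaulay_quotm R P Rn _ (rel_sub N K) d Nn NP.
split=> h P maxP => [NP|/supp_quotm NP]; apply/E => //.
- by move=> k ck; apply: Vd; apply: chain_lengths_sub ck => p; exact: suppN_rel_sub_supp.
- by apply: h => //; apply/supp_quotm.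
- by move=> k ck; apply: Vd; apply: chain_lengths_sub ck => p; exact: suppN_rel_sub_supp.
- exact: h.
Qed.

(** $F_n$ inside $F_{n+1}$: with [W] the module $F_{n+1}$ and [N] this set, the local notions speak
    of $F_{n+1}/F_n$. *)
Definition layer n : set (subm (dimfilt V n.+1)) :=
  [set` rel_sub (dimfilt V n.+1) (dimfilt V n)].
Arguments layer n : clear implicits.

Lemma sequentially_cmat : sequentially_cohen_macaulay V <->
  forall n P, maximal P -> suppN (layer n) P -> cmat P (layer n).
Proof.
rewrite (sequentially_cohen_macaulayP Rn Vd).
by split=> h n; apply/cohen_macaulay_subquot; apply: h.
Qed.

(** [p] is the annihilator of the class of [v] in the layer. The representative stays in [V], where
    [ann_le] applies. *)
Definition layer_ass n (p : prime_idealr R) (v : V) :=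
  v \in dimfilt V n.+1 /\ forall a, (a \in p) <-> a *: v \in dimfilt V n.

Lemma layer_ass_ann_le n p v : layer_ass n p v -> ann_le v p.
Proof. by move=> [_ pE] a av; apply/pE; rewrite av; exact: (@rpred0 _ (dimfilt V n)). Qed.

Lemma layer_chain n k : chain_lengths (suppN (layer n)) k -> (k <= n)%N.
Proof.
move=> [q [qs qlt]]; have [v /dimfiltP vF vq] := suppN_rel_sub (qs 0%N isT).
rewrite -ltnS; apply: vF; exists q; split=> // i ik; apply: ann_le_up vq _.
exact: chain_sub qlt _ _ _ _.
Qed.

(** As [v] is outside $F_n$, a chain of length [n] lies over its annihilator. Its least prime
    contains [p]: for $a \in p$ outside that prime, the chain would also lie over the annihilator of
    $av$, which is in $F_n$. *)
Lemma layer_ass_dim n p v : layer_ass n p v ->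
  chain_lengths (fun q => {subset p <= q}) n.
Proof.
move=> [vF pE].
have nvF : ~ v \in dimfilt V n.
  by move=> h; have := idealr1 p; rewrite (pE 1).2 // scale1r.
apply: contrapT => nch; apply: nvF; apply/dimfiltP => k ck.
rewrite ltnNge; apply/negP => nk; apply: nch.
have [q [qs qlt]] := chain_lengths_le nk ck; exists q; split=> // i ik a ap.
have sub j : (j <= n)%N -> {subset q 0%N <= q j} by move=> jn; apply: chain_sub qlt _ _ _ _.
apply: (sub i ik); apply: contrapT => /negP aq.
have := (pE a).1 ap; move=> /dimfiltP/(_ n); rewrite ltnn => h.
suff : false by []. apply: h; exists q; split=> // j jn.
exact: ann_le_up (ann_le_mulP (qs 0%N isT) aq) (sub j jn).
Qed.

(** Some associated prime [q] of [V], the annihilator of a multiple of [v], lies inside [p]. Were it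
    smaller, placing it below the chain of length [n] above [p] would contradict $v \in F_{n+1}$. *)
Lemma layer_ass_ass n p v : layer_ass n p v -> ass V p.
Proof.
move=> pA; have [vF pE] := pA.
have [|b [q [qp qE]]] := @exists_assoc R V Rn p [set 0] v (submodule0 V).
  exact/ann_le_sat/(layer_ass_ann_le pA).
suff pq : {subset p <= q}.
  exists (b *: v) => a; apply/idP/eqP => [/pq/qE|/qE/qp]; by [].
move=> a ap; apply: contrapT => /negP aq.
have /dimfiltP/(_ n.+1) := vF; rewrite ltnn => h; suff : false by [].
apply: h; apply: (@chain_lengthsS _ _ q).
  by move=> c cv; apply/qE; rewrite /= scaleCA cv scaler0.
apply: chain_lengths_sub (layer_ass_dim pA) => r pr; split.
  exact: ann_le_up (layer_ass_ann_le pA) pr.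
split=> [c /qp/pr|rq] //.
by move/negP: aq; apply; apply/rq/pr.
Qed.

Lemma layer_ass_supp n p v : layer_ass n p v -> suppN (layer n) p.
Proof.
move=> [vF pE]; exists (Sub v vF) => -[s sp sv].
by move/negP: sp; apply; apply/pE.
Qed.

Lemma exists_layer_ass n P v : v \in dimfilt V n.+1 ->
  ~ sat P [set` dimfilt V n] v ->
  exists b p, {subset p <= P} /\ layer_ass n p (b *: v).
Proof.
move=> vF nv; have [b [p [pP pE]]] := exists_assoc Rn (submodulep (dimfilt V n)) nv.
by exists b, p; split=> //; split=> //; apply: (@rpredZ _ _ (dimfilt V n.+1)).
Qed.

(* [c] is the coheight of [P] in the localization at a maximal ideal above it, hence
   0 when [P] is maximal. *)
Lemma dimfilt_locm P c :
  chain_lengths (fun q => {subset P <= q}) c ->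
  (forall m p v, layer_ass m p v -> {subset p <= P} ->
     chain_lengths (fun q => {subset p <= q} /\ {subset q <= P}) (m - c)%N) ->
  forall n v, (locm_of P v \in dimfilt (locm P V) n) <->
    sat P [set` dimfilt V (n + c)%N] v.
Proof.
move=> Pc Pass n v.
have ann_leE q : ann_le (locm_of P v) q <-> ann_le v (contraction q).
  split=> [h a av|h x xv].
    by rewrite contractP; apply: h; rewrite -locm_ofZ av locm_of_eq0; apply: sub_sat.
  have [s [a [sP E]]] := locr_of_surj x; rewrite (in_contract _ sP E).
  have : locm_of P (a *: v) = 0 by rewrite locm_ofZ -E -scalerA xv scaler0.
  move=> /locm_of_eq0[t tP]; rewrite /= scalerA => /h.
  by rewrite prime_idealrM => /orP[/contract_sub|//]; move/negP: tP.
have chE k : chain_lengths (ann_le (locm_of P v)) k <->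
    chain_lengths (fun q => ann_le v q /\ {subset q <= P}) k.
  rewrite -chain_lengths_contract; last by move=> p q; apply: ann_le_up.
  by split; apply: chain_lengths_sub => q /ann_leE.
rewrite dimfiltP; split=> [h|[s sP /dimfiltP h] k /chE ck]; last first.
  (* A chain inside [P] is prolonged by the [c] steps above [P], still over the annihilator of $sv$
     because [s] is outside [P]. *)
  rewrite -(ltn_add2r c); apply: h.
  apply: (@chain_lengths_cat _ _ P) => //; first by move=> p q; apply: ann_le_up.
  apply: chain_lengths_sub ck => q [vq qP]; split=> //.
  by apply: ann_le_mulP => //; apply: contraNN sP => /qP.
(* Take [m] least with [v] in the saturation of $F_m$. If $m > n + c$, an associated prime of layer
   $m - 1$ inside [P] carries a chain of length $m - 1 - c \ge n$ over the annihilator of [v], which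
   [h] forbids. *)
have : exists m, `[< sat P [set` dimfilt V m] v >].
  by exists d.+1; apply/asboolP; apply: sub_sat; exact: dimfilt_top.
case/ex_minnP => m /asboolP[s sP sv] mmin.
have [mn|] := leqP m (n + c)%N.
  by exists s => //; exact: dimfilt_mono mn _ sv.
case: m => [//|m] in sv mmin *; rewrite ltnS => nm.
have [|b [p [pP pA]]] := @exists_layer_ass m P (s *: v) sv.
  by move=> /(satZ sP) h'; have := mmin m (asboolT h'); rewrite ltnn.
have : (m - c < n)%N.
  apply: h; apply/chE; apply: chain_lengths_sub (Pass _ _ _ pA pP) => q [pq qP].
  by split=> //; apply: ann_leZ; apply: ann_leZ; apply: ann_le_up (layer_ass_ann_le pA) pq.
lia.
Qed.

End Layers.

Arguments layer {R} V n.

(** * Passage between a module and its localizations *)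

Section LocalGlobal.
Variables (R : comNzRingType) (M : lmodType R) (d : nat).
Hypotheses (Rn : noetherian_module R^o) (Mn : noetherian_module M).
Hypothesis Md : forall k, chain_lengths (supp M) k -> (k <= d)%N.
Hypothesis dim_quot : forall p Q : prime_idealr R, ass M p -> maximal Q ->
  {subset p <= Q} -> forall k, chain_lengths (fun q => {subset p <= q}) k ->
  chain_lengths (fun q => {subset p <= q} /\ {subset q <= Q}) k.

(** The coheight hypothesis enters here; it applies because [p] is associated to [M] itself. *)
Lemma layer_ass_chain (Q p : prime_idealr R) m (v : M) : maximal Q -> {subset p <= Q} ->
  layer_ass m p v -> chain_lengths (fun q => {subset p <= q} /\ {subset q <= Q}) m.
Proof.
move=> maxQ pQ pA; apply: dim_quot => //; first exact: layer_ass_ass pA.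
exact: layer_ass_dim pA.
Qed.

Lemma sequentially_of_locm :
  (forall P : prime_idealr R, supp M P -> sequentially_cohen_macaulay (locm P M)) ->
  sequentially_cohen_macaulay M.
Proof.
move=> cmP; apply/(sequentially_cmat Rn Mn Md) => n Q maxQ Qn.
have MQ : supp M Q by exact: suppN_rel_sub_supp Qn.
have filtE k v : (locm_of Q v \in dimfilt (locm Q M) k) <-> sat Q [set` dimfilt M k] v.
  (* At a maximal ideal the shift is 0. *)
  rewrite -{2}(addn0 k); apply: (@dimfilt_locm _ _ d) => //.
    by apply: (@chain_lengths0 _ _ Q) => a.
  by move=> m p w pA pQ; rewrite subn0; apply: layer_ass_chain pA.
have [supE cmE] := cmat_subquot (filtE n.+1) (filtE n).
apply/cmE; have := cmP Q MQ.
rewrite (sequentially_cmat (locr_noetherian (P := Q) Rn)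
  (noetherian_localization (locm_localization Q M) Mn) (locm_supp_bound Md)).
apply; first exact: (local_maximal (@locr_max_unit _ Q)).
by apply/supE; apply: suppN_up Qn _ => a; rewrite locr_maxP.
Qed.

Section NonMaximal.
Variables (P Q : prime_idealr R) (c : nat).
Hypotheses (maxQ : maximal Q) (PQ : {subset P <= Q}).
Hypothesis Pc : chain_lengths (fun q => {subset P <= q} /\ {subset q <= Q}) c.
Hypothesis c_max : forall k,
  chain_lengths (fun q => {subset P <= q} /\ {subset q <= Q}) k -> (k <= c)%N.
Hypothesis cmM : sequentially_cohen_macaulay M.

(** The dimension of the layer at [Q] is [m]: at most by [layer_chain], at least by the coheight
    hypothesis. Its regular sequence of length [m] is moved into [P] at the cost of [c] terms and
    then localized. *)
Lemma layer_grade m p (v : M) : layer_ass m p v -> {subset p <= P} ->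
  grade_ge P P (m - c)%N (layer M m).
Proof.
move=> pA pP; have sL : submodule (layer M m) by exact: submodulep.
have pQ : {subset p <= Q} by move=> a /pP/PQ.
have Wn := subm_noetherian (N := dimfilt M m.+1) Mn.
have supp_p := layer_ass_supp pA.
have [k [kc kmax gk]] : cmat Q (layer M m).
  by apply: (sequentially_cmat Rn Mn Md).1 => //; apply: suppN_up supp_p pQ.
have km : k = m.
  apply/eqP; rewrite eqn_leq; apply/andP; split.
    by apply: (@layer_chain _ M); apply: chain_lengths_sub kc => q [].
  apply: kmax; apply: chain_lengths_sub (layer_ass_chain maxQ pQ pA) => q [pq qQ].
  by split=> //; apply: suppN_up supp_p pq.
rewrite km in gk; apply: (grade_localize sL PQ).
exact: grade_descent PQ c_max gk.
Qed.

(** [grade_chain] applied at [P]. This is the input with which [dimfilt_locm] identifies the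
    localized filtration. *)
Lemma layer_ass_chain_local m p (v : M) : layer_ass m p v -> {subset p <= P} ->
  chain_lengths (fun q => {subset p <= q} /\ {subset q <= P}) (m - c)%N.
Proof.
move=> pA pP; have sL : submodule (layer M m) by exact: submodulep.
have Wn := subm_noetherian (N := dimfilt M m.+1) Mn.
have [vF pE] := pA.
apply: (grade_chain Rn Wn sL (layer_grade pA pP) pP (v := Sub v vF)) => a.
split=> [/pE av|[s sP]]; first exact: sub_sat.
move=> h; have : s * a \in p by apply/pE; rewrite -scalerA; exact: h.
by rewrite prime_idealrM => /orP[/pP|//]; move/negP: sP.
Qed.

(** The dimension at [P] is $m - c$: a longer chain below [P], continued by the [c] steps from [P]
    to [Q], would exceed the bound [m] for the layer. *)
Lemma cmat_layer m : suppN (layer M m) P -> cmat P (layer M m).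
Proof.
move=> [x nx]; have vF : val x \in dimfilt M m.+1 by exact: valP x.
have [|b [p [pP pA]]] := exists_layer_ass Rn (P := P) vF.
  by move=> [s sP h]; apply: nx; exists s.
exists (m - c)%N; split; last exact: layer_grade pA pP.
  apply: chain_lengths_sub (layer_ass_chain_local pA pP) => q [pq qP]; split=> //.
  exact: suppN_up (layer_ass_supp pA) pq.
move=> k kc; suff : (k + c <= m)%N by lia.
apply: (@layer_chain _ M); apply: chain_lengths_cat kc _; first exact: suppN_up.
by apply: chain_lengths_sub Pc => q [].
Qed.

End NonMaximal.

Lemma locm_sequentially (P : prime_idealr R) : supp M P ->
  sequentially_cohen_macaulay M -> sequentially_cohen_macaulay (locm P M).
Proof.
move=> MP cmM.
have [||Q [maxQ PQ]] := exists_maximal Rn (J := [set a : R^o | (a : R) \in P]).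
- exact: prime_idealr_sub.
- by rewrite /= idealr1.
(* The maximum exists because all primes above [P] belong to the support of [M], whose chains are
   bounded by [d]. *)
have [c Pc cmax] : exists2 c,
    chain_lengths (fun q => {subset P <= q} /\ {subset q <= Q}) c &
    forall k, chain_lengths (fun q => {subset P <= q} /\ {subset q <= Q}) k -> (k <= c)%N.
  apply: (@nat_max _ 0%N d); first by apply: (@chain_lengths0 _ _ P); split=> // a.
  move=> k ck; apply: Md; apply: chain_lengths_sub ck => q [Pq _].
  by apply/supp_suppN; apply: suppN_up Pq; apply/supp_suppN.
have filtE n v : (locm_of P v \in dimfilt (locm P M) n) <->
    sat P [set` dimfilt M (n + c)%N] v.
  apply: (@dimfilt_locm _ _ d) => //; first by apply: chain_lengths_sub Pc => q [].
  by move=> m p w; exact: (layer_ass_chain_local maxQ PQ cmax cmM).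
apply/(sequentially_cmat (locr_noetherian (P := P) Rn)
  (noetherian_localization (locm_localization P M) Mn) (locm_supp_bound Md)).
move=> n q maxq.
have [supE cmE] := cmat_subquot (filtE n.+1) (filtE n).
have -> : q = locr_max P.
  by apply: prime_ext => x; apply: maximal_local => //; exact: locr_max_unit.
move=> /supE h; apply/cmE; apply: (@cmat_layer P Q c) => //.
by apply: suppN_up h _ => a; rewrite locr_maxP.
Qed.

End LocalGlobal.

(** * Equality of dimensions rephrased by chains of primes, and the equivalence *)

Theorem theorem1p1 (R : comNzRingType) (M : lmodType R) (d : nat)
    (R_noetherian : noetherian R) (M_fingen : fingen M)
    (M_neq0 : exists x : M, x != 0) (M_dim : mdim M = (d%:Z)%:E)
    (dim_quot : forall p P : prime_idealr R,
       ass M p -> maximal P -> {subset p <= P} ->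
       mdim (quotm (ideal_pred p)) = mdim (quotm (extended_ideal p P))) :
  sequentially_cohen_macaulay M <->
  (forall P : prime_idealr R, supp M P ->
     sequentially_cohen_macaulay (locm P M)).
Proof.
have Rn := noetherian_ring R_noetherian.
have Mn := noetherian_fingen R_noetherian M_fingen.
have [_ Md] := nat_sup_eq M_dim.
have dim_quot' (p Q : prime_idealr R) : ass M p -> maximal Q ->
    {subset p <= Q} -> forall k, chain_lengths (fun q => {subset p <= q}) k ->
    chain_lengths (fun q => {subset p <= q} /\ {subset q <= Q}) k.
  move=> pM maxQ pQ.
  have E1 : chain_lengths (supp (quotm (ideal_pred p))) =
      chain_lengths (fun q => {subset p <= q}).
    apply/seteqP; split; apply: chain_lengths_sub => q; rewrite supp_quotm suppN_ideal //;
      exact: prime_idealr_sub.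
  have E2 : chain_lengths (supp (quotm (extended_ideal p Q))) =
      chain_lengths (fun q => {subset p <= q} /\ {subset q <= Q}).
    have sE : submodule [set` extended_ideal p Q] by exact: submodulep.
    (* A prime of $R_Q$ contains $pR_Q$ exactly when its contraction contains [p]; contraction then
       turns chains of such primes into chains between [p] and [Q]. *)
    have supE q : supp (quotm (extended_ideal p Q)) q <-> {subset p <= contraction q}.
      rewrite supp_quotm suppN_ideal //; split=> [h a ap|h x].
        by rewrite contractP; apply: h; apply/asboolP => K; apply; exists a.
      have [K KE] := set_submodClosed (prime_idealr_sub q).
      move=> /asboolP/(_ K) xK; apply/KE/xK => _ [a ap ->].
      by apply/KE; rewrite /= -[lfracr _ _]/(locr_of Q a) -contractP; apply: h.
    apply/seteqP; split=> n.
      move=> h; apply/(@chain_lengths_contract _ Q (fun q => {subset p <= q}) n).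
        by move=> q r pq qr a /pq/qr.
      by apply: chain_lengths_sub h => q /supE.
    move=> h; have [|_ /(_ h)] := @chain_lengths_contract _ Q (fun q => {subset p <= q}) n.
      by move=> q r pq qr a /pq/qr.
    by apply: chain_lengths_sub => q /supE.
  have [v vE] := pM.
  have E0 : chain_lengths (fun q => {subset p <= q}) 0.
    by apply: (@chain_lengths0 _ _ p) => a.
  (* [p] is the annihilator of [v], so every prime above it is in the support of [M]. *)
  have Ed k : chain_lengths (fun q => {subset p <= q}) k -> (k <= d)%N.
    move=> ck; apply: Md; apply: chain_lengths_sub ck => q pq.
    by apply: (@ann_le_supp _ _ v) => a /eqP; rewrite -vE => /pq.
  have [n Sn nmax] := nat_max E0 Ed.
  have := dim_quot p Q pM maxQ pQ.
  rewrite /mdim E1 E2 -!/(nat_sup _) (nat_sup_max Sn nmax).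
  (* The common dimension [n] is attained by a chain between [p] and [Q], which is truncated to
     length [k]. *)
  move=> /esym/nat_sup_eq[cn _] k /nmax kn; exact: chain_lengths_le cn.
split=> [cm P MP|]; last exact: (sequentially_of_locm Rn Mn Md dim_quot').
exact: (locm_sequentially Rn Mn Md dim_quot' MP cm).
Qed.
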